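(* There exists an $m$-decoupling pair (for some positive integer $m$) if and only if any of the following equivalent conditions holds: \begin{enumerate} \item[(1)] there exist a positive integer $m$ and a rational function $F$ such that $E^m(s)=\dfrac{F(y(s))}{F(y(1/s))}$; \item[(2)] there exist a positive integer $m$ and a rational function $H$ such that $E^m(s)=\dfrac{H(s)}{H(qs)}$; \item[(3)] $\alpha\in\mathbb{Z}+\frac{\pi}{\beta}\mathbb{Z}$, or $\{\alpha_1,\alpha_2\}\subset\mathbb{Z}+\frac{\pi}{\beta}\mathbb{Z}$. \end{enumerate} If these conditions hold, the function $F$ of assertion (1) is an $m$-decoupling function. Moreover, when $\alpha\in\mathbb{Z}+\frac{\pi}{\beta}\mathbb{Z}$ and $r\in\mathbb{Z}$ satisfies $s_1/s_2=q^r$, one can take in (1) $$m=1\quad\text{and}\quad F=F_{r,s_1}.$$ When $\{\alpha_1,\alpha_2\}\subset\mathbb{Z}+\frac{\pi}{\beta}\mathbb{Z}$ and the integers $r_1,r_2\in\mathbb{Z}$, $e_1,e_2,\epsilon_1,\epsilon_2\in\{0,1\}$ satisfy $s_i=(-1)^{\epsilon_i}\sqrt q^{\,e_i}q^{r_i}$ for $i=1,2$, one can take in (1) $$m=2\quad\text{and}\quad F=\left(\frac{F_{r_1,s_1}}{F_{r_2,s_2}}\right)^2\cdot\frac{f_{e_1,\epsilon_1}}{f_{e_2,\epsilon_2}}.$$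
   Context: Model. $\Sigma=\begin{pmatrix}\sigma_{11}&\sigma_{12}\\ \sigma_{12}&\sigma_{22}\end{pmatrix}$ is a real symmetric positive definite matrix, $\mu=(\mu_1,\mu_2)\in\mathbb{R}^2$, and $R=(r_{ij})_{1\le i,j\le2}$ is a real matrix with $r_{11}>0$, $r_{22}>0$. Standing assumptions: $\mu_1<0$, $\mu_2<0$, $\det R>0$, $r_{22}\mu_1-r_{12}\mu_2<0$, $r_{11}\mu_2-r_{21}\mu_1<0$. Angles. $\beta=\arccos\left(-\frac{\sigma_{12}}{\sqrt{\sigma_{11}\sigma_{22}}}\right)\in(0,\pi)$. $\theta=\arg(-\widetilde\mu)\in(-\pi,\pi]$, where $\widetilde\mu=\left(\frac{\mu_1\sigma_{22}-\mu_2\sigma_{12}}{\sqrt{\sigma_{22}\det\Sigma}},\frac{\mu_2}{\sqrt{\sigma_{22}}}\right)$ and $\arg$ is the polar angle. The angles $\delta,\varepsilon\in(0,\pi)$ are defined by $\cot\delta=\frac{1}{\sin\beta}\left(\frac{r_{12}}{r_{22}}\sqrt{\frac{\sigma_{22}}{\sigma_{11}}}+\cos\beta\right)$, $\cot\varepsilon=\frac{1}{\sin\beta}\left(\frac{r_{21}}{r_{11}}\sqrt{\frac{\sigma_{11}}{\sigma_{22}}}+\cos\beta\right)$. The standing assumptions are equivalent to $\delta-\pi<\beta-\varepsilon<\theta<\delta$ and $0<\theta<\beta$. Set $\alpha=\frac{\delta+\varepsilon-\pi}{\beta}$, $\alpha_1=\frac{2\varepsilon+\theta-\beta-\pi}{\beta}$,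 $\alpha_2=\frac{2\delta-\theta-\pi}{\beta}$. Kernel. $\gamma(x,y)=\frac12(\sigma_{11}x^2+2\sigma_{12}xy+\sigma_{22}y^2)+\mu_1x+\mu_2y$, $\gamma_1(x,y)=r_{11}x+r_{21}y$, $\gamma_2(x,y)=r_{12}x+r_{22}y$. $Y^\pm(x)$ are the two roots (algebraic functions of $x$) of $\gamma(x,y)=0$ solved for $y$. Decoupling. Rational functions have complex coefficients and are non-zero. An $m$-decoupling pair is a pair of rational functions $(F,L)$ such that $\left(\frac{\gamma_1}{\gamma_2}\right)^m(x,y)=\frac{F(y)}{L(x)}$ whenever $\gamma(x,y)=0$ (as identities between algebraic functions, with $y=Y^\pm(x)$). An $m$-decoupling function is a rational function $F$ such that, as algebraic functions, $\left(\frac{\gamma_1}{\gamma_2}\right)^m(x,Y^-(x))\Big/\left(\frac{\gamma_1}{\gamma_2}\right)^m(x,Y^+(x))=F(Y^-(x))/F(Y^+(x))$. Uniformization. With $\Delta=\mu_1^2\sigma_{22}-2\mu_1\mu_2\sigma_{12}+\mu_2^2\sigma_{11}$ and $y^\pm=\frac{(\mu_1\sigma_{12}-\mu_2\sigma_{11})\pm\sqrt{\sigma_{11}\Delta}}{\det\Sigma}$, put $y(s)=\frac{y^++y^-}{2}+\frac{y^+-y^-}{4}\left(\frac{s}{e^{i\beta}}+\frac{e^{i\beta}}{s}\right)$. Let $q=e^{2i\beta}$, $\sqrt q=e^{i\beta}$, $s_1=-e^{i(2\beta-2\varepsilon-\theta)}=e^{i\beta(1-\alpha_1)}$, $s_2=-e^{i(2\delta-\theta)}=e^{i\beta\alpha_2}$,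 and $$E(s)=\frac{s_2}{s_1}\,\frac{(s-s_1)(s-\frac1{s_2})}{(s-s_2)(s-\frac1{s_1})}.$$ For $r\in\mathbb{Z}$, $\sigma\in\mathbb{C}\setminus\{0\}$: $F_{r,\sigma}(y)=\prod_{j=0}^{r-1}(y-y(\sigma q^{-j}))$ if $r\ge0$ (empty product $=1$), and $F_{r,\sigma}(y)=\prod_{j=1}^{|r|}\frac{1}{y-y(\sigma q^j)}$ if $r<0$. For $e,\epsilon\in\{0,1\}$: $f_{e,\epsilon}(y)=1$ if $e=0$ and $f_{e,\epsilon}(y)=y-y((-1)^\epsilon\sqrt q)$ if $e=1$. *)

(* Defs.v *)
From mathcomp Require Import all_boot all_order all_algebra.
From mathcomp Require Import complex.
From mathcomp Require Import all_classical all_reals all_analysis.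

Set Implicit Arguments.
Unset Strict Implicit.
Unset Printing Implicit Defensive.

Import Order.TTheory GRing.Theory Num.Theory.
Local Open Scope ring_scope.

Definition ratfun (R : realType) : fieldType := {fraction {poly R[i]}}.

Definition rconst (R : realType) (c : R[i]) : ratfun R := FracField.tofrac c%:P.
Definition rvar (R : realType) : ratfun R := FracField.tofrac 'X.
Arguments rvar {R}.

(* [reval phi f u] is f(u) for u in an extension field K of the complex
   numbers, embedded by [phi]. It is computed from an arbitrary numerator and
   denominator of f, so it depends on f alone when u is transcendental over the
   complex numbers. This is the only case in which it is used below (for a model
   satisfying the standing assumptions). *)
Definition reval (R : realType) (K : fieldType) (phi : R[i] -> K)
    (f : ratfun R) (u : K) : K :=
  (map_poly phi (frac (repr f)).1).[u]
  / (map_poly phi (frac (repr f)).2).[u].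

Record model (R : realType) := Model {
  Sigma : 'M[R]_2;
  mu : 'rV[R]_2;
  refl : 'M[R]_2 }.

Definition sym_posdef (R : realType) (S : 'M[R]_2) : Prop :=
  S^T = S /\ forall v : 'cV[R]_2, v != 0 -> 0 < (v^T *m S *m v) 0 0.

Section ModelDefs.
Context {R : realType}.
Implicit Types (M : model R).

Definition s11 M : R := Sigma M 0 0.
Definition s12 M : R := Sigma M 0 1.
Definition s22 M : R := Sigma M 1 1.
Definition mu1 M : R := mu M 0 0.
Definition mu2 M : R := mu M 0 1.
Definition r11 M : R := refl M 0 0.
Definition r12 M : R := refl M 0 1.
Definition r21 M : R := refl M 1 0.
Definition r22 M : R := refl M 1 1.

Definition beta M : R := acos (- (s12 M / Num.sqrt (s11 M * s22 M))).

Definition mut1 M : R :=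
  (mu1 M * s22 M - mu2 M * s12 M) / Num.sqrt (s22 M * \det (Sigma M)).
Definition mut2 M : R := mu2 M / Num.sqrt (s22 M).

(* t = arg (x, y), with values in ]-pi, pi] *)
Definition is_arg (x y t : R) : Prop :=
  [/\ - pi < t <= pi,
      x = Num.sqrt (x ^+ 2 + y ^+ 2) * cos t
    & y = Num.sqrt (x ^+ 2 + y ^+ 2) * sin t].

Definition cot (t : R) : R := cos t / sin t.

Definition is_theta M (theta : R) : Prop := is_arg (- mut1 M) (- mut2 M) theta.

Definition is_delta M (delta : R) : Prop :=
  0 < delta < pi /\
  cot delta = (sin (beta M))^-1 *
    (r12 M / r22 M * Num.sqrt (s22 M / s11 M) + cos (beta M)).

Definition is_epsilon M (epsilon : R) : Prop :=
  0 < epsilon < pi /\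
  cot epsilon = (sin (beta M))^-1 *
    (r21 M / r11 M * Num.sqrt (s11 M / s22 M) + cos (beta M)).

Definition alpha M (delta epsilon : R) : R := (delta + epsilon - pi) / beta M.
Definition alpha1 M (theta epsilon : R) : R :=
  (2 * epsilon + theta - beta M - pi) / beta M.
Definition alpha2 M (theta delta : R) : R := (2 * delta - theta - pi) / beta M.

(* x belongs to Z + (pi / beta) Z *)
Definition in_ZpibetaZ M (x : R) : Prop :=
  exists a b : int, x = a%:~R + pi / beta M * b%:~R.

Section Kernel.
Variables (K : fieldType) (j : R -> K).
Definition gamma M (x y : K) : K :=
  2^-1 * (j (s11 M) * x ^+ 2 + 2 * j (s12 M) * x * y + j (s22 M) * y ^+ 2)
  + j (mu1 M) * x + j (mu2 M) * y.
Definition gamma1 M (x y : K) : K := j (r11 M) * x + j (r21 M) * y.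
Definition gamma2 M (x y : K) : K := j (r12 M) * x + j (r22 M) * y.
Definition gquot M (x y : K) : K := gamma1 M x y / gamma2 M x y.
End Kernel.

(* Algebraic functions of x are taken to be elements of extension fields
   [iota : C(x) -> K]: the functions Y^+-(x) are then the elements Y of K with
   gamma (x, Y) = 0, and an identity between algebraic functions is an identity
   in K, required in every K. *)
Definition cemb (K : fieldType) (iota : ratfun R -> K) (c : R[i]) : K :=
  iota (rconst c).
Definition remb (K : fieldType) (iota : ratfun R -> K) (c : R) : K :=
  cemb iota (c%:C)%C.

Definition decoupling_pair M (m : nat) (F L : ratfun R) : Prop :=
  [/\ F != 0, L != 0 &
    forall (K : fieldType) (iota : {rmorphism ratfun R -> K}) (Y : K),
      gamma (remb iota) M (iota rvar) Y = 0 ->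
      gquot (remb iota) M (iota rvar) Y ^+ m = reval (cemb iota) F Y / iota L].

Definition decoupling_function M (m : nat) (F : ratfun R) : Prop :=
  F != 0 /\
  forall (K : fieldType) (iota : {rmorphism ratfun R -> K}) (Ym Yp : K),
    gamma (remb iota) M (iota rvar) Ym = 0 ->
    gamma (remb iota) M (iota rvar) Yp = 0 ->
    Ym != Yp ->
    gquot (remb iota) M (iota rvar) Ym ^+ m
      / gquot (remb iota) M (iota rvar) Yp ^+ m
    = reval (cemb iota) F Ym / reval (cemb iota) F Yp.

Definition Delta M : R :=
  mu1 M ^+ 2 * s22 M - 2 * mu1 M * mu2 M * s12 M + mu2 M ^+ 2 * s11 M.
Definition yplus M : R :=
  (mu1 M * s12 M - mu2 M * s11 M + Num.sqrt (s11 M * Delta M))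
  / \det (Sigma M).
Definition yminus M : R :=
  (mu1 M * s12 M - mu2 M * s11 M - Num.sqrt (s11 M * Delta M))
  / \det (Sigma M).

(* e^(i t) *)
Definition expi (t : R) : R[i] := (cos t +i* sin t)%C.

Definition q M : R[i] := expi (2 * beta M).
Definition sqrtq M : R[i] := expi (beta M).
Definition s1 M (theta epsilon : R) : R[i] :=
  - expi (2 * beta M - 2 * epsilon - theta).
Definition s2 (theta delta : R) : R[i] := - expi (2 * delta - theta).

(* y(s), for s in an extension field K of the complex numbers *)
Definition yunif M (K : fieldType) (phi : R[i] -> K) (s : K) : K :=
  phi (((yplus M + yminus M) / 2)%:C)%C
  + phi (((yplus M - yminus M) / 4)%:C)%C
    * (s / phi (sqrtq M) + phi (sqrtq M) / s).

Definition yval M (s : R[i]) : R[i] := yunif M id s.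

(* F(y(s)), as a rational function of the variable, for a rational function s
   of that variable *)
Definition comp_y M (F : ratfun R) (s : ratfun R) : ratfun R :=
  reval (@rconst R) F (yunif M (@rconst R) s).

Definition Efun (s1 s2 : R[i]) : ratfun R :=
  rconst (s2 / s1) * ((rvar - rconst s1) * (rvar - rconst s2^-1))
  / ((rvar - rconst s2) * (rvar - rconst s1^-1)).

Definition E M (theta delta epsilon : R) : ratfun R :=
  Efun (s1 M theta epsilon) (s2 theta delta).

Definition E_eq_F M (theta delta epsilon : R) (m : nat) (F : ratfun R) : Prop :=
  F != 0 /\
  E M theta delta epsilon ^+ m = comp_y M F rvar / comp_y M F rvar^-1.

Definition E_eq_H M (theta delta epsilon : R) (m : nat) (H : ratfun R) : Prop :=
  H != 0 /\
  E M theta delta epsilon ^+ m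
  = reval (@rconst R) H rvar / reval (@rconst R) H (rconst (q M) * rvar).

Definition Frs M (r : int) (sigma : R[i]) : ratfun R :=
  match r with
  | Posz n => \prod_(0 <= j < n) (rvar - rconst (yval M (sigma * q M ^- j)))
  | Negz n => (* r = - n.+1 *)
      \prod_(1 <= j < n.+2) (rvar - rconst (yval M (sigma * q M ^+ j)))^-1
  end.

Definition fee M (e eps : bool) : ratfun R :=
  if e then rvar - rconst (yval M ((-1) ^+ eps * sqrtq M)) else 1.

End ModelDefs.

(* Main.v *)
Require Import Defs.
From HB Require Import structures.
From mathcomp Require Import all_boot all_order all_algebra.
From mathcomp Require Import complex.
From mathcomp Require Import ring lra.
From mathcomp Require Import all_classical all_reals all_analysis.

Import Order.TTheory GRing.Theory Num.Theory.
Local Open Scope ring_scope.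

(** The conic [gamma = 0] is rational.  After rescaling, it is parametrised by
    [s |-> (x(s), y(s))] where [x(s)] is an affine function of [s + 1/s] and
    [y(s)] an affine function of [s / w + w / s], with [w = e^(i beta)].  Hence
    [x(s)] is invariant under [s |-> 1/s], [y(s)] under [s |-> q / s], and the
    two involutions compose to [s |-> q s].  The lines [gamma1 = 0] and
    [gamma2 = 0] pass through the origin, which is the point
    [s = - e^(i theta)] of the conic, so each of them meets the conic in one
    further point, [s1] and [s2] respectively ([gquot_unif]):
      [g(s) = (gamma1 / gamma2)(x(s), y(s)) = c (s - s1) / (s - s2)].
    It follows that [E(s) = g(s) / g(1/s)] ([g_quotient]).

    Pairs and the equation for [F].  If [g^m = F(y) / L(x)], dividing by the image
    under [s |-> 1/s] removes [L] and leaves [E^m = F(y(s)) / F(y(1/s))].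
    Conversely that equation says that [F(y(s)) / g^m] is invariant under
    [s |-> 1/s], hence a rational function [L] of [x(s)] ([invariant_descent]).
    An identity in [C(s)] holds for algebraic functions in an arbitrary
    extension [K] of [C(x)], because every solution [Y] of [gamma(x, Y) = 0] in
    [K] comes from a morphism [C(s) -> K] carrying [x(s)] to [x] and [y(s)] to
    [Y] ([kernel_point]).  Two distinct solutions correspond to parameters
    [s] and [1/s], which gives the statement on decoupling functions.

    From [F] to [H]: as [y(1/s) = y(q s)], one can take [H(s) = F(y(s))].

    From [H] to the angles.  The number of zeros minus poles of [H(s)] in an
    orbit of [s |-> q s], finite or infinite, is the same for [H(q s)].  So in
    each orbit the zeros [s1], [1/s2] of [E] are balanced by its poles [s2], [1/s1]: either
    [s1 / s2] is a power of [q], or [s1^2] and [s2^2] both are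
    ([orbit_cancellation]).  Taking arguments turns this into the condition on
    [alpha], [alpha1] and [alpha2].

    From the angles to explicit [F].  Put
    [phi_a(s) = (s - a) / (a (s - 1/a))], so that [E = phi_s1 / phi_s2].  For
    [F(y) = y - y(a)] the quotient [F(y(s)) / F(y(1/s))] is
    [phi_a / phi_(a/q)]; the product defining [F_(r, a)] telescopes to
    [phi_a / phi_(a q^-r)] ([yquot_Frs]).  If [s1 / s2 = q^r] this is [E].  If
    [s_i = tau_i q^(r_i)] with [tau_i = +- w^(e_i)], the square of
    [F_(r1, s1) / F_(r2, s2)] gives [E^2] up to the factor
    [(phi_tau2 / phi_tau1)^2], which [f_(e1, eps1) / f_(e2, eps2)] compensates
    ([yquot_fee]). *)

Set Implicit Arguments.
Unset Strict Implicit.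
Unset Printing Implicit Defensive.

(** * Rational functions and their evaluation *)

Lemma subf_div (F : fieldType) (a b c d : F) : b != 0 -> d != 0 ->
  a / b - c / d = (a * d - c * b) / (b * d).
Proof. by move=> b0 d0; field; rewrite d0 b0. Qed.

Section RationalFunctions.
Context {R : realType}.
Local Notation C := R[i].
Local Notation tofrac := (@FracField.tofrac {poly C}).

Lemma ratfun_numden (f : ratfun R) :
  f = tofrac (frac (repr f)).1 / tofrac (frac (repr f)).2.
Proof.
rewrite -[LHS]reprK; move: (repr f) => x.
have dx : tofrac (frac x).2 != 0 by rewrite tofrac_eq0 denom_ratioP.
apply: (mulIf dx); rewrite divfK //; unlock FracField.tofrac.
rewrite -[LHS]FracField.pi_mul; apply/eqmodP => /=.
by rewrite FracField.equivfE /FracField.mulf /= !numden_Ratio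
  ?mulf_neq0 ?oner_neq0 ?denom_ratioP // !mulr1 mulrC.
Qed.

(** [C(s)] is generated, as a field, by the constants and [s]. *)
Lemma ratfun_ind (P : ratfun R -> Prop) :
  (forall c, P (rconst c)) -> P rvar ->
  (forall f g, P f -> P g -> P (f + g)) ->
  (forall f g, P f -> P g -> P (f * g)) ->
  (forall f, P f -> f != 0 -> P f^-1) -> forall f, P f.
Proof.
move=> Pc Px PD PM PV f.
have Pp (p : {poly C}) : P (tofrac p).
  elim/poly_ind: p => [|p c IHp]; first exact: (Pc 0).
  by rewrite rmorphD rmorphM; apply: PD; [exact: PM | exact: Pc].
rewrite (ratfun_numden f); apply: PM; first exact: Pp.
by apply: PV; rewrite ?tofrac_eq0 ?denom_ratioP.
Qed.

Lemma rconst_is_zmod_morphism : zmod_morphism (@rconst R).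
Proof. by move=> a b; rewrite /rconst !rmorphB. Qed.
HB.instance Definition _ :=
  GRing.isZmodMorphism.Build C (ratfun R) (@rconst R) rconst_is_zmod_morphism.
Lemma rconst_is_monoid_morphism : monoid_morphism (@rconst R).
Proof. by split=> [|a b]; rewrite /rconst ?rmorph1 // !rmorphM. Qed.
HB.instance Definition _ :=
  GRing.isMonoidMorphism.Build C (ratfun R) (@rconst R)
    rconst_is_monoid_morphism.

Section Evaluation.
Context {K : fieldType}.
Implicit Types (phi : {rmorphism C -> K}) (u : K).

(** Since the complex numbers are algebraically closed, an element of an
    extension is transcendental over them as soon as it is not a constant. *)
Definition nonconst (phi : C -> K) u := forall c : C, u != phi c.

Lemma horner_nonconst_neq0 phi u (p : {poly C}) :
  nonconst phi u -> p != 0 -> (map_poly phi p).[u] != 0.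
Proof.
move=> hu p0; have [rs ->] := closed_field_poly_normal p.
rewrite map_polyZ hornerZ mulf_neq0 ?fmorph_eq0 ?lead_coef_eq0 //.
rewrite map_prod_XsubC horner_prod prodf_seq_neq0; apply/allP => c _ /=.
by rewrite hornerXsubC subr_eq0 hu.
Qed.

Lemma reval_div phi u (n d : {poly C}) : nonconst phi u -> d != 0 ->
  reval phi (tofrac n / tofrac d) u
  = (map_poly phi n).[u] / (map_poly phi d).[u].
Proof.
move=> hu d0; rewrite /reval; set f := tofrac n / tofrac d.
have d'0 := denom_ratioP (repr f).
have E : (frac (repr f)).1 * d = n * (frac (repr f)).2.
  apply/eqP; rewrite -tofrac_eq !rmorphM /=.
  by rewrite -eqr_div ?tofrac_eq0 // -ratfun_numden.
apply/eqP; rewrite eqr_div ?horner_nonconst_neq0 // -!hornerM -!rmorphM.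
by rewrite E.
Qed.

(** At a non-constant point no denominator vanishes, so that evaluation is a
    field morphism.  This is how identities of rational functions are carried
    to an arbitrary extension. *)
Lemma eval_morphism phi u : nonconst phi u ->
  exists psi : {rmorphism ratfun R -> K},
    [/\ forall f, psi f = reval phi f u, psi rvar = u
      & forall c, psi (rconst c) = phi c].
Proof.
move=> hu; pose h f := reval phi f u.
have hE n d : d != 0 -> h (tofrac n / tofrac d)
    = (map_poly phi n).[u] / (map_poly phi d).[u] by exact: reval_div.
have hp p : h (tofrac p) = (map_poly phi p).[u].
  have -> : tofrac p = tofrac p / tofrac 1 by rewrite rmorph1 divr1.
  by rewrite hE ?oner_neq0 // rmorph1 hornerC divr1.
have fr (f : ratfun R) : exists n d, d != 0 /\ f = tofrac n / tofrac d.
  by do 2!eexists; split; last exact: ratfun_numden; exact: denom_ratioP.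
have dB : zmod_morphism h.
  move=> f g; have [n [d [d0 ->]]] := fr f; have [m [e [e0 ->]]] := fr g.
  have -> : tofrac n / tofrac d - tofrac m / tofrac e
      = tofrac (n * e - m * d) / tofrac (d * e).
    by rewrite subf_div ?tofrac_eq0 // rmorphB !rmorphM.
  rewrite !hE ?mulf_neq0 // subf_div ?horner_nonconst_neq0 //.
  by rewrite !(rmorphB, rmorphM) /= !hornerE.
have dM : monoid_morphism h.
  split=> [|f g]; first by rewrite -(rmorph1 tofrac) hp rmorph1 hornerC.
  have [n [d [d0 ->]]] := fr f; have [m [e [e0 ->]]] := fr g.
  rewrite mulf_div -!rmorphM !hE ?mulf_neq0 // mulf_div.
  by rewrite !(rmorphM, hornerM) /=.
pose hA := GRing.isZmodMorphism.Build _ _ h dB.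
pose hM := GRing.isMonoidMorphism.Build _ _ h dM.
pose psi : {rmorphism ratfun R -> K} := HB.pack h hA hM.
exists psi; split=> [//||c].
  by rewrite -[LHS]/(h (tofrac 'X)) hp map_polyX hornerX.
by rewrite -[LHS]/(h (tofrac c%:P)) hp map_polyC hornerC.
Qed.
End Evaluation.

Lemma rmorph_reval (K L : fieldType) (psi : {rmorphism K -> L})
    (phi : {rmorphism C -> K}) (f : ratfun R) (u : K) :
  psi (reval phi f u) = reval (psi \o phi) f (psi u).
Proof. by rewrite /reval fmorph_div -!horner_map -!map_poly_comp. Qed.

Lemma nonconst_rvar : nonconst (@rconst R) rvar.
Proof.
move=> c; rewrite -subr_eq0 /rvar /rconst -rmorphB tofrac_eq0.
by rewrite polyXsubC_eq0.
Qed.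

Lemma reval_rvar (f : ratfun R) : reval (@rconst R) f rvar = f.
Proof.
rewrite [RHS]ratfun_numden /reval.
have E (p : {poly C}) : (map_poly (@rconst R) p).[rvar] = tofrac p.
  have -> : map_poly (@rconst R) p = map_poly tofrac (map_poly polyC p).
    by rewrite -map_poly_comp; apply: eq_map_poly.
  by rewrite /rvar horner_map /= -/(p \Po 'X) comp_polyXr.
by rewrite !E.
Qed.

Lemma rmorph_ratfunE (K : fieldType) (iota : {rmorphism ratfun R -> K}) f :
  iota f = reval (cemb iota) f (iota rvar).
Proof. by rewrite -[in LHS](reval_rvar f) rmorph_reval. Qed.

End RationalFunctions.

(** * Functions invariant under inversion *)

Section InvariantFunctions.
Context {R : realType}.
Local Notation C := R[i].

Lemma nonconst_neq0 (K : fieldType) (phi : {rmorphism C -> K}) (u : K) :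
  nonconst phi u -> u != 0.
Proof. by move=> /(_ 0); rewrite rmorph0. Qed.

Lemma nonconstV (K : fieldType) (phi : {rmorphism C -> K}) (u : K) :
  nonconst phi u -> nonconst phi u^-1.
Proof. by move=> hu c; rewrite -[_ == _](inj_eq invr_inj) invrK -fmorphV hu. Qed.

(** Otherwise [u] would be a root of a quadratic polynomial over the complex
    numbers. *)
Lemma nonconst_joukowski (K : fieldType) (phi : {rmorphism C -> K}) (u : K)
    (a b t : C) : b != 0 -> nonconst phi u ->
  nonconst phi (phi a + phi b * (u + phi t / u)).
Proof.
move=> b0 hu c; apply/eqP => E; have u0 := nonconst_neq0 hu.
pose p : {poly C} := 'X^2 - ((c - a) / b)%:P * 'X + t%:P.
have p0 : p != 0.
  apply/eqP => /(congr1 (fun p : {poly C} => p`_2)).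
  rewrite /p !coefE mulr0 subr0 addr0 => /eqP; exact/negP/oner_neq0.
have /eqP[] := horner_nonconst_neq0 hu p0.
have -> : (map_poly phi p).[u] = u ^+ 2 - (phi c - phi a) / phi b * u + phi t.
  rewrite /p rmorphD rmorphB /= map_polyXn rmorphM /= map_polyX !map_polyC /=.
  by rewrite !hornerE fmorph_div rmorphB.
by rewrite -E; field; rewrite u0 fmorph_eq0 b0.
Qed.

(** With [iota k] the field of functions of [s + 1/s], every function of [s] is
    [a + b s] with [a] and [b] in [iota k]: such expressions form a field, since
    [s^2 = (s + 1/s) s - 1] and [a + b s] has norm [(a + b s) (a + b / s)]. *)
Section Quadratic.
Variables (k F : fieldType) (iota : {rmorphism k -> F}) (s : F) (v : k).
Hypotheses (s0 : s != 0) (iv : iota v = s + s^-1).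

Definition in_quadratic (g : F) := exists a b, g = iota a + iota b * s.

Lemma in_quadraticD g h :
  in_quadratic g -> in_quadratic h -> in_quadratic (g + h).
Proof.
move=> [a [b ->]] [c [d ->]]; exists (a + c), (b + d).
by rewrite !rmorphD mulrDl addrACA.
Qed.

Lemma in_quadraticM g h :
  in_quadratic g -> in_quadratic h -> in_quadratic (g * h).
Proof.
move=> [a [b ->]] [c [d ->]].
exists (a * c - b * d), (a * d + b * c + b * d * v).
by rewrite !(rmorphD, rmorphN, rmorphM) /= iv; field.
Qed.

Lemma in_quadraticV a b : iota a + iota b * s != 0 ->
  iota a + iota b * s^-1 != 0 -> in_quadratic (iota a + iota b * s)^-1.
Proof.
move=> h1 h2; pose N := a ^+ 2 + a * b * v + b ^+ 2.
have NE : iota N = (iota a + iota b * s) * (iota a + iota b * s^-1).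
  by rewrite /N !(rmorphXn, rmorphD, rmorphM) /= iv; field.
have E : iota a + iota b * s^-1 = (iota a * s + iota b) / s by field.
have h3 : iota a * s + iota b != 0.
  by apply: contra h2 => /eqP h; rewrite E h mul0r.
exists ((a + b * v) / N), (- b / N).
rewrite !fmorph_div NE !(rmorphD, rmorphN, rmorphM) /= iv.
by field; rewrite s0 h3 h1.
Qed.
End Quadratic.

(** A function [a + b s] equals its image [a + b / s] under inversion only if
    [b = 0]. *)
Lemma invariant_descent (iota inv : {rmorphism ratfun R -> ratfun R})
    (f : ratfun R) (v : ratfun R) :
  (forall c, iota (rconst c) = rconst c) ->
  (forall h, inv (iota h) = iota h) ->
  inv rvar = rvar^-1 -> iota v = rvar + rvar^-1 -> inv f = f ->
  exists h, f = iota h.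
Proof.
move=> ic ii is_ iv fE.
have s0 : rvar != 0 :> ratfun R := nonconst_neq0 nonconst_rvar.
have P g : in_quadratic iota rvar g.
  elim/(@ratfun_ind R): g => [c||g h|g h|g [a [b ->]] g0].
  - by exists (rconst c), 0; rewrite ic rmorph0 mul0r addr0.
  - by exists 0, 1; rewrite rmorph0 rmorph1 mul1r add0r.
  - exact: in_quadraticD.
  - exact: (in_quadraticM s0 iv).
  - apply: (in_quadraticV s0 iv g0).
    by rewrite -is_ -(ii a) -(ii b) -rmorphM -rmorphD fmorph_eq0.
have [a [b E]] := P f; exists a.
move: fE; rewrite {1 2}E rmorphD rmorphM !ii is_ => /addrI/eqP.
have [b0|b0] := eqVneq b 0; first by rewrite E b0 rmorph0 !mul0r addr0.
rewrite (inj_eq (mulfI _)) ?fmorph_eq0 // => /eqP h.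
(* [b != 0] would force [s^2 = 1], making [s] one of the constants [1], [-1]. *)
have /eqP : rvar ^+ 2 = 1 :> ratfun R by rewrite expr2 -{1}h mulVf.
rewrite sqrf_eq1 -(rmorph1 (@rconst R)) -rmorphN.
by rewrite !(negPf (nonconst_rvar _)).
Qed.

End InvariantFunctions.

(** * Counting zeros and poles in an invariant set *)

Section OrbitDegree.
Context {R : realType}.
Local Notation C := R[i].
Local Notation tofrac := (@FracField.tofrac {poly C}).
Variable O : pred C.

Definition nroots (p : {poly C}) : nat :=
  count O (sval (closed_field_poly_normal p)).

Lemma nroots_prod (c : C) (rs : seq C) : c != 0 ->
  nroots (c *: \prod_(z <- rs) ('X - z%:P)) = count O rs.
Proof.
move=> c0; rewrite /nroots; case: closed_field_poly_normal => ss /= E.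
move: E; rewrite lead_coefZ lead_coef_prod_XsubC mulr1.
by move=> /(scalerI c0)/prod_XsubC_eq/permP->.
Qed.

Lemma nrootsM (p r : {poly C}) : p != 0 -> r != 0 ->
  nroots (p * r) = (nroots p + nroots r)%N.
Proof.
have [rs Ep] := closed_field_poly_normal p.
have [ss Er] := closed_field_poly_normal r.
rewrite -lead_coef_eq0 -(lead_coef_eq0 r) => p0 r0.
rewrite [in LHS]Ep [in LHS]Er -scalerAl -scalerAr scalerA -big_cat.
by rewrite nroots_prod ?mulf_neq0 // count_cat Ep Er !nroots_prod
  // !lead_coefZ !lead_coef_prod_XsubC !mulr1.
Qed.

Lemma nroots_XsubC a : nroots ('X - a%:P) = O a :> nat.
Proof.
have := @nroots_prod 1 [:: a] (oner_neq0 _).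
by rewrite big_seq1 scale1r /= addn0.
Qed.

Lemma nroots_polyC (c : C) : c != 0 -> nroots c%:P = 0%N.
Proof.
by move=> c0; have := @nroots_prod c [::] c0; rewrite big_nil alg_polyC.
Qed.

Lemma nroots_dilate (k : C) (p : {poly C}) :
  k != 0 -> (forall z, O (k * z) = O z) -> p != 0 ->
  nroots (p \Po (k *: 'X)) = nroots p.
Proof.
move=> k0 Ok; have [rs Ep] := closed_field_poly_normal p.
rewrite -lead_coef_eq0 => p0.
have E : p \Po (k *: 'X) = (lead_coef p * k ^+ size rs) *:
    \prod_(z <- [seq z / k | z <- rs]) ('X - z%:P).
  rewrite {1}Ep comp_polyZ -scalerA; congr (_ *: _).
  elim: (rs) => [|z zs IH] /=.
    by rewrite !big_nil scale1r -polyC1 comp_polyC.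
  rewrite !big_cons comp_polyM IH comp_polyB comp_polyX comp_polyC.
  have -> : k *: 'X - z%:P = k *: ('X - (z / k)%:P).
    by rewrite scalerBr -[k *: _%:P]mul_polyC -polyCM mulrCA divff // mulr1.
  by rewrite exprS -scalerAl -scalerAr scalerA.
rewrite E nroots_prod ?mulf_neq0 ?expf_neq0 // [in RHS]Ep nroots_prod //.
by rewrite count_map; apply: eq_count => z /=; rewrite -Ok mulrC divfK.
Qed.

(** The number of zeros minus the number of poles of [f] in [O].  Numerator and
    denominator may have a common factor, whose roots cancel out
    ([orbdeg_frac]). *)
Definition orbdeg (f : ratfun R) : int :=
  (nroots (frac (repr f)).1)%:Z - (nroots (frac (repr f)).2)%:Z.

Lemma orbdeg_frac (n d : {poly C}) : n != 0 -> d != 0 ->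
  orbdeg (tofrac n / tofrac d) = (nroots n)%:Z - (nroots d)%:Z.
Proof.
move=> n0 d0; rewrite /orbdeg; set f := tofrac n / tofrac d.
have f0 : f != 0 by rewrite mulf_neq0 ?invr_eq0 ?tofrac_eq0.
have d'0 : (frac (repr f)).2 != 0 := denom_ratioP (repr f).
have n'0 : (frac (repr f)).1 != 0.
  apply: contra f0 => /eqP E.
  by rewrite (ratfun_numden f) E rmorph0 mul0r.
have /(congr1 nroots) : (frac (repr f)).1 * d = n * (frac (repr f)).2.
  apply/eqP; rewrite -tofrac_eq !rmorphM /=.
  by rewrite -eqr_div ?tofrac_eq0 // -ratfun_numden.
rewrite !nrootsM // => /(congr1 Posz); rewrite !PoszD => E.
by apply/eqP; rewrite subr_eq addrAC eq_sym subr_eq E.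
Qed.

Lemma ratfun_fraction (f : ratfun R) : f != 0 ->
  exists n d : {poly C}, [/\ n != 0, d != 0 & f = tofrac n / tofrac d].
Proof.
move=> f0; exists (frac (repr f)).1, (frac (repr f)).2.
split; [|exact: denom_ratioP|exact: ratfun_numden].
by apply: contra f0 => /eqP E; rewrite (ratfun_numden f) E rmorph0 mul0r.
Qed.

Lemma orbdegM f g : f != 0 -> g != 0 -> orbdeg (f * g) = orbdeg f + orbdeg g.
Proof.
move=> /ratfun_fraction[n [d [n0 d0 ->]]] /ratfun_fraction[m [e [m0 e0 ->]]].
rewrite mulf_div -!rmorphM !orbdeg_frac ?mulf_neq0 // !nrootsM //.
by rewrite !PoszD opprD addrACA.
Qed.

Lemma orbdeg_rconst (c : C) : c != 0 -> orbdeg (rconst c) = 0.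
Proof.
move=> c0; rewrite /rconst -[tofrac _]divr1 -(rmorph1 tofrac).
by rewrite orbdeg_frac ?oner_neq0 ?polyC_eq0 // !nroots_polyC ?oner_neq0.
Qed.

Lemma orbdeg1 : orbdeg 1 = 0.
Proof.
have -> : 1 = rconst 1 :> ratfun R by rewrite rmorph1.
by rewrite orbdeg_rconst ?oner_neq0.
Qed.

Lemma orbdegV f : f != 0 -> orbdeg f^-1 = - orbdeg f.
Proof.
move=> f0; have f'0 : f^-1 != 0 by rewrite invr_eq0.
have := orbdegM f'0 f0; rewrite (mulVf f0) orbdeg1 => /esym/eqP.
by rewrite addr_eq0 => /eqP.
Qed.

Lemma orbdegX f m : f != 0 -> orbdeg (f ^+ m) = orbdeg f *+ m.
Proof.
move=> f0; elim: m => [|m IH].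
  by rewrite expr0 orbdeg1.
by rewrite exprS orbdegM ?expf_neq0 // IH mulrS.
Qed.

Lemma rvar_subE a : rvar - rconst a = tofrac ('X - a%:P).
Proof. by rewrite rmorphB. Qed.

Lemma rvar_sub_neq0 (a : C) : rvar - rconst a != 0.
Proof. by rewrite rvar_subE tofrac_eq0 polyXsubC_eq0. Qed.

Lemma orbdeg_rvar_sub a : orbdeg (rvar - rconst a) = (O a : nat)%:Z.
Proof.
rewrite rvar_subE -[tofrac _]divr1 -(rmorph1 tofrac).
rewrite orbdeg_frac ?oner_neq0 ?polyXsubC_eq0 // nroots_XsubC.
by rewrite nroots_polyC ?oner_neq0 ?subr0.
Qed.

(** The zeros and poles of [f(k s)] are those of [f(s)] divided by [k], and the
    set [O] is stable under multiplication by [k]. *)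
Lemma orbdeg_dilate (k : C) (f : ratfun R) :
  k != 0 -> (forall z, O (k * z) = O z) -> f != 0 ->
  orbdeg (reval (@rconst R) f (rconst k * rvar)) = orbdeg f.
Proof.
move=> k0 Ok /ratfun_fraction[n [d [n0 d0 ->]]].
have kX : nonconst (@rconst R) (rconst k * rvar).
  have := @nonconst_joukowski R _ (@rconst R) rvar 0 k 0 k0 nonconst_rvar.
  by rewrite !rmorph0 add0r mul0r addr0.
have cX0 (p : {poly C}) : p != 0 -> p \Po (k *: 'X) != 0.
  by move=> p0; rewrite comp_poly2_eq0 // size_scale // size_polyX.
have E (p : {poly C}) : (map_poly (@rconst R) p).[rconst k * rvar]
    = tofrac (p \Po (k *: 'X)).
  have -> : map_poly (@rconst R) p = map_poly tofrac (map_poly polyC p).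
    by rewrite -map_poly_comp; apply: eq_map_poly.
  by rewrite /rconst /rvar -rmorphM /= horner_map /= mul_polyC.
by rewrite reval_div // !E !orbdeg_frac ?cX0 // !nroots_dilate.
Qed.
End OrbitDegree.

(** * The unit circle *)

Section UnitCircle.
Context {R : realType}.
Local Notation C := R[i].

Lemma expi0 : expi 0 = 1 :> C.
Proof. by rewrite /expi cos0 sin0. Qed.

Lemma expiD (s t : R) : expi (s + t) = expi s * expi t.
Proof.
by apply/eqP; rewrite eq_complex /= cosD sinD eqxx /= addrC.
Qed.

Lemma expiN (t : R) : expi (- t) = (expi t)^-1.
Proof.
have h : expi (- t) * expi t = 1 by rewrite -expiD addNr expi0.
have t0 : expi t != 0.
  by apply/eqP => t0; move: h; rewrite t0 mulr0 => /esym/eqP; rewrite oner_eq0.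
by apply: (mulIf t0); rewrite h mulVf.
Qed.

Lemma expi_neq0 (t : R) : expi t != 0.
Proof.
apply/eqP => t0; have := expiD t (- t).
by rewrite t0 mul0r subrr expi0 => /eqP; rewrite oner_eq0.
Qed.

Lemma expi_pi : expi pi = -1 :> C.
Proof.
by rewrite /expi cospi sinpi; apply/eqP; rewrite eq_complex /= oppr0 !eqxx.
Qed.

Lemma expi_mulz (t : R) (k : int) : expi (t * k%:~R) = expi t ^ k.
Proof.
have nat_case (n : nat) : expi (t * n%:R) = expi t ^+ n.
  elim: n => [|n IH]; first by rewrite mulr0 expi0.
  by rewrite mulrS mulrDr mulr1 expiD IH exprS.
case: k => n; first by rewrite -exprnP -nat_case.
by rewrite -[RHS]/((expi t ^+ n.+1)^-1) -nat_case NegzE mulrNz mulrN expiN.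
Qed.

(** Reduce [t] to [u] with [0 <= u < 2 pi].  Then [cos u = 1] gives
    [sin (u/2) = 0] by the half-angle formula, while [0 <= u/2 < pi]. *)
Lemma expi_eq1 (t : R) : expi t = 1 <-> exists k : int, t = 2 * pi * k%:~R.
Proof.
have pi2 : 0 < 2 * pi :> R by rewrite mulr_gt0 ?pi_gt0.
have e2pi : expi (2 * pi) = 1 :> C.
  by rewrite mulr_natl mulr2n expiD expi_pi mulrNN mulr1.
split=> [|[k ->]]; last by rewrite expi_mulz e2pi exp1rz.
pose k := Num.floor (t / (2 * pi)); move=> t1.
exists k; apply/eqP; rewrite -subr_eq0; apply/negPn/negP => u0.
set u := t - _ in u0.
have /andP[uge ult] : 0 <= u < 2 * pi.
  have := floor_itv (t / (2 * pi)); rewrite -/k => /andP[].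
  rewrite ler_pdivlMr // ltr_pdivrMr // intrD => a b.
  by rewrite /u; apply/andP; split; lra.
have : expi u = 1.
  by rewrite /u expiD t1 mul1r -mulrN -mulrNz expi_mulz e2pi exp1rz.
have s0 : 0 < sin (u / 2).
  have u1 : 0 < u by rewrite lt_def u0.
  by apply: sin_gt0_pi; apply/andP; split; lra.
have uE : u = (u / 2) *+ 2 by rewrite -mulr_natr divfK.
rewrite {1}uE /expi => -[c1 _]; move: c1; rewrite cos_mulr2n cos2sin2.
by move=> c1; have := exprn_gt0 2 s0; lra.
Qed.

Lemma expi_inj_2pi (s t : R) :
  expi s = expi t <-> exists k : int, s = t + 2 * pi * k%:~R.
Proof.
have -> : expi s = expi t <-> expi (s - t) = 1.
  rewrite expiD expiN; split=> [->|h]; first by rewrite divff ?expi_neq0.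
  by rewrite -[LHS](divfK (expi_neq0 t)) h mul1r.
rewrite expi_eq1; split=> -[k E]; exists k; first by rewrite -E addrC subrK.
by rewrite E addrC addKr.
Qed.

Definition imagC : C := (0 +i* 1)%C.

Lemma imagC_sqr : imagC ^+ 2 = -1.
Proof.
by apply/eqP; rewrite expr2 eq_complex /=; apply/andP; split; apply/eqP; ring.
Qed.

Lemma cos_expi (t : R) : ((cos t)%:C)%C = (expi t + (expi t)^-1) / 2.
Proof.
rewrite -expiN /expi cosN sinN.
have -> : (cos t +i* sin t + cos t +i* - sin t = (cos t)%:C * 2)%C.
  apply/eqP; rewrite eq_complex /=.
  by apply/andP; split; apply/eqP; ring.
by rewrite mulfK ?pnatr_eq0.
Qed.

Lemma sin_expi (t : R) :
  ((sin t)%:C)%C = - imagC / 2 * (expi t - (expi t)^-1).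
Proof.
rewrite -expiN /expi cosN sinN.
have -> : (cos t +i* sin t - cos t +i* - sin t = imagC * (sin t)%:C * 2)%C.
  apply/eqP; rewrite eq_complex /=.
  by apply/andP; split; apply/eqP; ring.
have n2 : 2 != 0 :> C by rewrite pnatr_eq0.
rewrite [RHS](_ : _ = - imagC ^+ 2 * ((sin t)%:C)%C); last by field.
by rewrite imagC_sqr opprK mul1r.
Qed.
End UnitCircle.

(** * Normal form of the model *)

Section NormalForm.
Context {R : realType}.
Implicit Types (M : model R).

Lemma posdef_entries M : sym_posdef (Sigma M) ->
  [/\ 0 < s11 M, 0 < s22 M, s12 M ^+ 2 < s11 M * s22 M
    & \det (Sigma M) = s11 M * s22 M - s12 M ^+ 2].
Proof.
case=> symS pos.
have S10 : Sigma M 1 0 = s12 M by rewrite -[in LHS]symS mxE.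
have quad (a b : R) : (a != 0) || (b != 0) ->
    0 < s11 M * a ^+ 2 + 2 * s12 M * a * b + s22 M * b ^+ 2.
  move=> ab; pose v : 'cV[R]_2 := \col_i (if i == 0 then a else b).
  have v0 : v != 0.
    apply/eqP => /matrixP v0; move: ab.
    have := v0 0 0; have := v0 1 0; rewrite !mxE /= => -> ->.
    by rewrite eqxx.
  have := pos v v0; rewrite !mxE !big_ord_recl big_ord0 !mxE /=.
  rewrite !big_ord_recl big_ord0 !mxE /=.
  have -> : lift ord0 (ord0 : 'I_1) = 1 :> 'I_2 by apply/val_inj.
  rewrite S10 -/(s11 M) -/(s12 M) -/(s22 M) big_ord0 !addr0.
  by congr (_ < _); ring.
have a0 : 0 < s11 M by have := quad 1 0; rewrite oner_neq0 => /(_ isT); lra.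
have c0 : 0 < s22 M.
  by have := quad 0 1; rewrite oner_neq0 orbT => /(_ isT); lra.
split=> //; last first.
  rewrite (expand_det_row _ 0) !big_ord_recl big_ord0 /cofactor !det_mx11 !mxE /=.
  have -> : lift ord0 (ord0 : 'I_1) = 1 :> 'I_2 by apply/val_inj.
  have -> : lift 1 (ord0 : 'I_1) = 0 :> 'I_2 by apply/val_inj.
  by rewrite S10 -/(s11 M) -/(s12 M) -/(s22 M); ring.
have := quad (- s12 M) (s11 M); rewrite (gt_eqF a0) orbT => /(_ isT) h.
by rewrite -subr_gt0 -(pmulr_rgt0 _ a0); lra.
Qed.

(** Coordinates in which the conic depends on angles only.  With
    [x = A X] and [y = B Y],
      [gamma / m = (X^2 - 2 cos(beta) X Y + Y^2) / 2
         + sin(beta) sin(theta - beta) X - sin(beta) sin(theta) Y],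
    a conic with centre [(cos theta, cos(theta - beta))]. *)
Record normal_form M (theta A B m : R) : Prop := NormalForm {
  nf_A : 0 < A; nf_B : 0 < B; nf_m : 0 < m;
  nf_s11 : s11 M = m / A ^+ 2;
  nf_s22 : s22 M = m / B ^+ 2;
  nf_s12 : s12 M = - (m / (A * B)) * cos (beta M);
  nf_mu1 : mu1 M = m / A * (sin (beta M) * sin (theta - beta M));
  nf_mu2 : mu2 M = - (m / B) * (sin (beta M) * sin theta);
  nf_ymid : (yplus M + yminus M) / 2 = B * cos (theta - beta M);
  nf_yamp : (yplus M - yminus M) / 4 = B / 2 }.

(** With [N] the length of [mu~], [p = sqrt sigma11] and [r = sqrt sigma22], the
    definitions of [beta] and [theta] read [sigma12 = - p r cos beta],
    [mu1 = N p sin (theta - beta)] and [mu2 = - N r sin theta]; moreover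
    [det Sigma = (p r sin beta)^2] and [Delta = N^2 det Sigma].  Hence
    [A = N / (p sin beta)], [B = N / (r sin beta)], [m = (N / sin beta)^2]. *)
Lemma normal_formP M theta : sym_posdef (Sigma M) -> mu2 M < 0 ->
  is_theta M theta ->
  0 < sin (beta M) /\ exists A B m, normal_form M theta A B m.
Proof.
move=> /posdef_entries[a0 c0 D0 detE] mu20 [_ th1 th2].
set p := Num.sqrt (s11 M); set r := Num.sqrt (s22 M).
have p0 : 0 < p by rewrite sqrtr_gt0.
have r0 : 0 < r by rewrite sqrtr_gt0.
have pE : s11 M = p ^+ 2 by rewrite sqr_sqrtr // ltW.
have rE : s22 M = r ^+ 2 by rewrite sqr_sqrtr // ltW.
have prE : Num.sqrt (s11 M * s22 M) = p * r by rewrite sqrtrM // ltW.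
pose x := s12 M / (p * r).
have s12E : s12 M = x * (p * r) by rewrite /x divfK // mulf_neq0 ?gt_eqF.
have x1 : x ^+ 2 < 1.
  move: D0; rewrite -subr_gt0.
  have -> : s11 M * s22 M - s12 M ^+ 2 = (1 - x ^+ 2) * (p * r) ^+ 2.
    by rewrite s12E pE rE; ring.
  by rewrite pmulr_lgt0 ?subr_gt0 // exprn_gt0 // mulr_gt0.
have xb : -1 <= - x <= 1.
  by rewrite -ler_norml normrN -(ler_pXn2r (ltn0Sn 1)) ?nnegrE //
    expr1n real_normK ?num_real // ltW.
have cb : cos (beta M) = - x by rewrite /beta prE acosK // in_itv.
have sb0 : 0 < sin (beta M).
  by rewrite /beta prE sin_acos // sqrtr_gt0 sqrrN subr_gt0.
have cs : cos (beta M) ^+ 2 = 1 - sin (beta M) ^+ 2 by rewrite -cos2sin2.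
set sb := sin (beta M) in sb0 cs *; set cb' := cos (beta M) in cb cs *.
have {}s12E : s12 M = - cb' * (p * r) by rewrite cb opprK.
have {}detE : \det (Sigma M) = (p * r * sb) ^+ 2.
  rewrite detE s12E pE rE !exprMn sqrrN cs; ring.
have sD : Num.sqrt (s22 M * \det (Sigma M)) = r * (p * r * sb).
  rewrite rE detE -exprMn sqrtr_sqr ger0_norm //.
  by rewrite ltW // !mulr_gt0.
set N := Num.sqrt _ in th1 th2.
have prs0 : 0 < p * r * sb by rewrite !mulr_gt0.
have m2 : mu2 M = - N * r * sin theta.
  move: th2; rewrite /mut2 -/r => th2.
  by rewrite mulrAC mulNr -th2 opprK divfK ?gt_eqF.
have N0 : 0 < N.
  rewrite lt_def sqrtr_ge0 andbT; apply/eqP => N0.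
  by move: mu20; rewrite m2 N0 oppr0 !mul0r ltxx.
have m1 : mu1 M = N * p * sin (theta - beta M).
  move: th1; rewrite /mut1 sD => th1.
  have {}th1 : - (mu1 M * s22 M - mu2 M * s12 M)
      = N * cos theta * (r * (p * r * sb)).
    by rewrite -th1 mulNr divfK // gt_eqF // mulr_gt0.
  have h : mu1 M * r ^+ 2 = N * p * sin (theta - beta M) * r ^+ 2.
    rewrite -rE sinB -/sb -/cb' rE.
    have -> : mu1 M * r ^+ 2
        = mu2 M * s12 M - N * cos theta * (r * (p * r * sb)).
      by rewrite -th1 rE; ring.
    by rewrite m2 s12E; ring.
  by apply: (mulIf _ h); rewrite expf_neq0 // gt_eqF.
have DE : Delta M = (N * (p * r * sb)) ^+ 2.
  rewrite /Delta m1 m2 s12E pE rE sinB -/sb -/cb'.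
  have cst : cos theta ^+ 2 = 1 - sin theta ^+ 2 by rewrite -cos2sin2.
  transitivity (N ^+ 2 * p ^+ 2 * r ^+ 2 * (
    (sin theta ^+ 2 * (1 - cb' ^+ 2) + cos theta ^+ 2 * sb ^+ 2))).
    by ring.
  by rewrite cst cs; ring.
have sDE : Num.sqrt (s11 M * Delta M) = p * (N * (p * r * sb)).
  by rewrite pE DE -exprMn sqrtr_sqr ger0_norm // ltW // !mulr_gt0.
have [pn rn sn] : [/\ p != 0, r != 0 & sb != 0] by rewrite !gt_eqF.
have Nn : N != 0 by rewrite gt_eqF.
split=> //; exists (N / (p * sb)), (N / (r * sb)), (N ^+ 2 / sb ^+ 2).
split; rewrite ?divr_gt0 ?mulr_gt0 ?exprn_gt0 // -/sb -/cb'.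
- by rewrite pE; field; rewrite pn sn Nn.
- by rewrite rE; field; rewrite rn sn Nn.
- by rewrite s12E; field; rewrite pn rn sn Nn.
- by rewrite m1; field; rewrite pn sn Nn.
- by rewrite m2; field; rewrite rn sn Nn.
- have -> : (yplus M + yminus M) / 2
    = (mu1 M * s12 M - mu2 M * s11 M) / \det (Sigma M).
    rewrite /yplus /yminus detE; field.
    by rewrite pn rn sn.
  rewrite m1 m2 s12E pE detE sinB cosB -/sb -/cb'.
  transitivity
    (N / r * (cb' * cos theta * sb + sin theta * (1 - cb' ^+ 2)) / sb ^+ 2).
    by field; rewrite pn rn sn.
  by rewrite cs; field; rewrite rn sn.
- rewrite /yplus /yminus detE sDE; field.
  by rewrite pn rn sn.
Qed.

(** Multiply by [sin t sin b]: [rho sin t = cos t sin b - cos b sin t]. *)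
Lemma cot_reflection (b t rho : R) : 0 < sin b -> 0 < t < pi ->
  cot t = (sin b)^-1 * (rho + cos b) -> rho = sin (b - t) / sin t.
Proof.
move=> sb0 /sin_gt0_pi st0; rewrite /cot => h.
have E : rho = cos t / sin t * sin b - cos b.
  by rewrite h; field; rewrite gt_eqF.
by rewrite E sinB; field; rewrite gt_eqF.
Qed.

Lemma sqrt_quot (m A B : R) : 0 < A -> 0 < B -> 0 < m ->
  Num.sqrt ((m / A ^+ 2) / (m / B ^+ 2)) = B / A.
Proof.
move=> A0 B0 m0; rewrite [X in Num.sqrt X](_ : _ = (B / A) ^+ 2).
  by rewrite sqrtr_sqr ger0_norm // divr_ge0 // ltW.
by field; rewrite !gt_eqF.
Qed.

(** The defining equations of [delta] and [epsilon] say that the coefficient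
    vectors of [gamma2] and [gamma1], in normalised coordinates, are
    proportional to [(sin (beta - delta), sin delta)] and
    [(sin epsilon, sin (beta - epsilon))]. *)
Lemma reflection_direction (b t u v A B m : R) :
  0 < A -> 0 < B -> 0 < m -> 0 < u -> 0 < sin b -> 0 < t < pi ->
  cot t = (sin b)^-1 *
    (v / u * Num.sqrt ((m / A ^+ 2) / (m / B ^+ 2)) + cos b) ->
  exists2 l : R, l != 0 & u * A = l * sin t /\ v * B = l * sin (b - t).
Proof.
move=> A0 B0 m0 u0 sb0 tpi; rewrite sqrt_quot // => /(cot_reflection sb0 tpi) E.
have st0 := sin_gt0_pi tpi.
exists (u * A / sin t); first by rewrite gt_eqF // divr_gt0 ?mulr_gt0.
split; first by rewrite divfK // gt_eqF.
rewrite -mulrA [_^-1 * _]mulrC -E; field.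
by rewrite !gt_eqF.
Qed.
End NormalForm.

(** * Uniformization of the kernel curve *)

Section Uniformization.
Context {R : realType} {K : fieldType} (phi : {rmorphism R[i] -> K}).
Context {M : model R} {theta A B m : R}.
Hypotheses (nf : normal_form M theta A B m) (sb0 : 0 < sin (beta M)).
Local Notation C := R[i].
Definition embR : {rmorphism R -> K} := phi \o real_complex R.
Local Notation W := (phi (sqrtq M)).
Local Notation T := (phi (expi theta)).

Definition xunif (s : K) : K :=
  phi ((A * cos theta)%:C)%C + phi ((A / 2)%:C)%C * (s + s^-1).

Lemma embRE c : phi (c%:C)%C = embR c. Proof. by []. Qed.

Lemma embR_rmorph : (forall a b, embR (a * b) = embR a * embR b) *
  (forall a b, embR (a + b) = embR a + embR b) * (forall a, embR (- a) = - embR a) *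
  (forall a, embR a^-1 = (embR a)^-1) * (forall a n, embR (a ^+ n) = embR a ^+ n) *
  (forall n, embR n%:R = n%:R).
Proof.
by do !split=> *;
  rewrite !(rmorphM, rmorphD, rmorphN, fmorphV, rmorphXn, rmorph_nat) /=.
Qed.

Lemma embR_neq0 (a : R) : a != 0 -> embR a != 0.
Proof. by rewrite fmorph_eq0. Qed.

Lemma natr_ext_neq0 n : n.+1%:R != 0 :> K.
Proof. by rewrite -(rmorph_nat phi) fmorph_eq0 pnatr_eq0. Qed.

Lemma phi_expi_neq0 t : phi (expi t) != 0.
Proof. by rewrite fmorph_eq0 expi_neq0. Qed.

Lemma embR_cos t : embR (cos t) = (phi (expi t) + (phi (expi t))^-1) / 2.
Proof.
rewrite -embRE cos_expi fmorph_div rmorphD fmorphV.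
by rewrite -[2 in LHS]/(2%:R) rmorph_nat.
Qed.

Lemma embR_sin t : embR (sin t) = - phi imagC / 2 * (phi (expi t) - (phi (expi t))^-1).
Proof.
rewrite -embRE sin_expi rmorphM rmorphB fmorph_div rmorphN !fmorphV.
by rewrite -[2 in LHS]/(2%:R) rmorph_nat.
Qed.

Lemma embR_sin_sin s t : embR (sin s * sin t) =
  - (phi (expi s) - (phi (expi s))^-1) * (phi (expi t) - (phi (expi t))^-1) / 4.
Proof.
rewrite embR_rmorph !embR_sin.
have i2 : phi imagC ^+ 2 = -1 by rewrite -rmorphXn imagC_sqr rmorphN1.
rewrite [LHS](_ : _ = phi imagC ^+ 2 * ((phi (expi s) - (phi (expi s))^-1)
  * (phi (expi t) - (phi (expi t))^-1) / 4)); last first.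
  field; rewrite !phi_expi_neq0 (natr_ext_neq0 1) (natr_ext_neq0 3) //.
by rewrite i2 mulN1r !mulNr.
Qed.

Lemma phi_expiB s t : phi (expi (s - t)) = phi (expi s) / phi (expi t).
Proof. by rewrite expiD expiN rmorphM fmorphV. Qed.

Lemma sqrtq_sqr_neq1 : W ^+ 2 - 1 != 0.
Proof.
have W0 : W != 0 := phi_expi_neq0 _.
have : embR (sin (beta M)) != 0 by rewrite embR_neq0 // gt_eqF.
rewrite embR_sin; apply: contra => /eqP h.
have -> : phi (expi (beta M)) - (phi (expi (beta M)))^-1 = (W ^+ 2 - 1) / W.
  by rewrite -/(sqrtq M); field.
by rewrite h mul0r mulr0.
Qed.

Lemma xunifE s : xunif s = embR A / 2 * (s + s^-1 + (T + T^-1)).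
Proof.
rewrite /xunif !embRE !embR_rmorph embR_cos; set u := s + s^-1; field.
by rewrite phi_expi_neq0 (natr_ext_neq0 1).
Qed.

Lemma yunifE s : yunif M phi s = embR B / 2 * (s / W + W / s + (T / W + W / T)).
Proof.
rewrite /yunif (nf_ymid nf) (nf_yamp nf) !embRE !embR_rmorph embR_cos phi_expiB.
rewrite invf_div -/(sqrtq M).
set u := s / W + W / s; set v := T / W + W / T; field.
by rewrite (natr_ext_neq0 1).
Qed.

(** The right-hand side is the quadratic relation between [s + 1/s] and
    [s / w + w / s]; the constants added to [U] and [V] move the centre of the
    conic to the origin. *)
Lemma gammaE U V :
  gamma embR M (embR A / 2 * (U + (T + T^-1))) (embR B / 2 * (V + (T / W + W / T)))
  = embR m / 8 * (U ^+ 2 + V ^+ 2 - (W + W^-1) * U * V + (W - W^-1) ^+ 2).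
Proof.
have W0 : W != 0 := phi_expi_neq0 _.
have T0 : T != 0 := phi_expi_neq0 _.
have A0 : embR A != 0 by rewrite embR_neq0 // gt_eqF // (nf_A nf).
have B0 : embR B != 0 by rewrite embR_neq0 // gt_eqF // (nf_B nf).
rewrite /gamma (nf_s11 nf) (nf_s12 nf) (nf_s22 nf) (nf_mu1 nf) (nf_mu2 nf).
have E1 : embR (m / A * (sin (beta M) * sin (theta - beta M)))
    = embR m / embR A * (- (W - W^-1) * (T / W - (T / W)^-1) / 4).
  by rewrite embR_rmorph embR_sin_sin !embR_rmorph phi_expiB.
have E2 : embR (- (m / B) * (sin (beta M) * sin theta))
    = - (embR m / embR B) * (- (W - W^-1) * (T - T^-1) / 4).
  by rewrite embR_rmorph embR_sin_sin !embR_rmorph.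
have E3 : embR (- (m / (A * B)) * cos (beta M))
    = - (embR m / (embR A * embR B)) * ((W + W^-1) / 2).
  by rewrite embR_rmorph embR_cos !embR_rmorph.
rewrite E1 E2 E3 !embR_rmorph.
field.
by rewrite A0 B0 W0 T0 (natr_ext_neq0 1) (natr_ext_neq0 3) (natr_ext_neq0 7).
Qed.

Lemma gamma_unif s : s != 0 -> gamma embR M (xunif s) (yunif M phi s) = 0.
Proof.
move=> s0; rewrite xunifE yunifE gammaE.
have W0 : W != 0 := phi_expi_neq0 _.
rewrite [X in _ * X](_ : _ = 0) ?mulr0 //.
by field; rewrite s0 W0.
Qed.

(** Every point of the conic over [K] has its parameter in [K]: [s] and [1/s]
    are linear combinations of [U] and [V], because [w != 1/w]; the equation of
    the conic says that the two combinations are inverse to each other. *)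
Lemma gamma_eq0_unif x y : gamma embR M x y = 0 ->
  exists s, [/\ s != 0, x = xunif s & y = yunif M phi s].
Proof.
have W0 : W != 0 := phi_expi_neq0 _.
have A0 : embR A != 0 by rewrite embR_neq0 // gt_eqF // (nf_A nf).
have B0 : embR B != 0 by rewrite embR_neq0 // gt_eqF // (nf_B nf).
have m0 : embR m != 0 by rewrite embR_neq0 // gt_eqF // (nf_m nf).
have two0 := natr_ext_neq0 1.
pose U := 2 * x / embR A - (T + T^-1); pose V := 2 * y / embR B - (T / W + W / T).
have xE : x = embR A / 2 * (U + (T + T^-1)).
  by rewrite /U subrK; field; rewrite two0 A0.
have yE : y = embR B / 2 * (V + (T / W + W / T)).
  by rewrite /V subrK; field; rewrite two0 B0.
have c0 : embR m / 8 != 0 by rewrite mulf_neq0 ?invr_eq0 ?(natr_ext_neq0 7).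
rewrite {1}xE {1}yE gammaE => /eqP; rewrite mulf_eq0 (negPf c0) /=.
have W1 := sqrtq_sqr_neq1.
pose s := (W * V - W ^+ 2 * U) / (1 - W ^+ 2).
pose s' := (W * V - U) / (W ^+ 2 - 1).
move=> /eqP h.
have W2 : 1 - W ^+ 2 != 0 by rewrite -opprB oppr_eq0.
have ss : s * s' = 1.
  apply/eqP; rewrite -subr_eq0; apply/eqP.
  rewrite [LHS](_ : _ = - W ^+ 2 / (W ^+ 2 - 1) ^+ 2
    * (U ^+ 2 + V ^+ 2 - (W + W^-1) * U * V + (W - W^-1) ^+ 2)).
    by rewrite h mulr0.
  by rewrite /s /s'; field; rewrite W0 W1 W2.
have s0 : s != 0.
  apply/eqP => s0; move: ss; rewrite s0 mul0r => /esym/eqP.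
  by rewrite oner_eq0.
have s'E : s' = s^-1 by apply: (mulfI s0); rewrite ss divff.
exists s; split=> //.
  rewrite xunifE -s'E {1}xE; congr (_ * (_ + _)).
  by rewrite /s /s'; field; rewrite W1 W2.
rewrite yunifE -s'E {1}yE; congr (_ * (_ + _)).
by rewrite /s /s'; field; rewrite W0 W1 W2.
Qed.

(** Both linear forms vanish at the origin, which accounts for the common factor
    [s + e^(i theta)].  Their other zeros come from the identities
    [sin epsilon + sin (beta - epsilon) e^(i beta)
       = sin beta e^(i (beta - epsilon))] and
    [sin (beta - delta) + sin delta e^(i beta) = sin beta e^(i delta)]. *)
Lemma gquot_unif epsilon delta :
  0 < r11 M -> 0 < r22 M -> is_epsilon M epsilon -> is_delta M delta ->
  exists2 c : C, c != 0 & forall s, s != 0 -> s + T != 0 ->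
    gquot embR M (xunif s) (yunif M phi s)
    = phi c * ((s - phi (s1 M theta epsilon)) / (s - phi (s2 theta delta))).
Proof.
move=> r1 r2 he hd.
case: he; case: hd; rewrite (nf_s11 nf) (nf_s22 nf) => dpi cotd epi cote.
have [[A0 B0] m0] := (nf_A nf, nf_B nf, nf_m nf).
have [l1 l10 [e1 e2]] := reflection_direction A0 B0 m0 r1 sb0 epi cote.
have [l2 l20 [d1 d2]] := reflection_direction B0 A0 m0 r2 sb0 dpi cotd.
pose e := phi (expi epsilon); pose d := phi (expi delta).
have e0 : e != 0 := phi_expi_neq0 _.
have d0 : d != 0 := phi_expi_neq0 _.
have W0 : W != 0 := phi_expi_neq0 _.
have T0 : T != 0 := phi_expi_neq0 _.
have l1n := embR_neq0 l10; have l2n := embR_neq0 l20.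
exists ((l1 / l2)%:C%C * (expi epsilon * expi delta / sqrtq M)).
  rewrite !mulf_neq0 ?invr_eq0 ?expi_neq0 //.
  by rewrite fmorph_eq0 mulf_neq0 ?invr_eq0.
move=> s s0 sT.
have two0 := natr_ext_neq0 1.
have i0 : phi imagC != 0.
  by rewrite fmorph_eq0 -sqrf_eq0 imagC_sqr oppr_eq0 oner_eq0.
have W1 := sqrtq_sqr_neq1.
have z1E : phi (s1 M theta epsilon) = - (W ^+ 2 / (e ^+ 2 * T)).
  rewrite /s1 rmorphN 2!phi_expiB; congr (- _).
  rewrite !mulr_natl !mulr2n !expiD !rmorphM -/(sqrtq M) -/e.
  by field; rewrite e0 T0.
have z2E : phi (s2 theta delta) = - (d ^+ 2 / T).
  by rewrite /s2 rmorphN phi_expiB mulr_natl mulr2n expiD rmorphM -expr2.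
(* What [gamma1] and [gamma2] have in common on the curve. *)
pose k := - phi imagC / 2 * (W - W^-1) * (s + T) / (2 * s).
have g1 : gamma1 embR M (xunif s) (yunif M phi s)
    = k * embR l1 * (e / W) * (s - phi (s1 M theta epsilon)).
  rewrite /gamma1 xunifE yunifE.
  transitivity ((embR (r11 M * A) * (s + s^-1 + (T + T^-1))
    + embR (r21 M * B) * (s / W + W / s + (T / W + W / T))) / 2).
    by rewrite !embR_rmorph; field; rewrite ?s0 ?W0 ?T0 ?two0.
  rewrite e1 e2 !embR_rmorph !embR_sin phi_expiB z1E -/(sqrtq M) -/e /k.
  by field; rewrite s0 W0 T0 e0 two0.
have g2 : gamma2 embR M (xunif s) (yunif M phi s)
    = k * embR l2 / d * (s - phi (s2 theta delta)).
  rewrite /gamma2 xunifE yunifE.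
  transitivity ((embR (r12 M * A) * (s + s^-1 + (T + T^-1))
    + embR (r22 M * B) * (s / W + W / s + (T / W + W / T))) / 2).
    by rewrite !embR_rmorph; field; rewrite ?s0 ?W0 ?T0 ?two0.
  rewrite d1 d2 !embR_rmorph !embR_sin phi_expiB z2E -/(sqrtq M) -/d /k.
  by field; rewrite s0 W0 T0 d0 two0.
have k0 : k != 0.
  have -> : k = - phi imagC / 2 * ((W ^+ 2 - 1) / W) * (s + T) / (2 * s).
    by rewrite /k; field; rewrite s0 W0 two0.
  by rewrite !mulf_neq0 ?invr_eq0 ?oppr_eq0 ?mulf_neq0.
have cE : phi ((l1 / l2)%:C%C * (expi epsilon * expi delta / sqrtq M))
    = embR l1 / embR l2 * (e * d / W) by rewrite !rmorphM !fmorphV.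
rewrite /gquot g1 g2 cE.
(* At the pole both sides are quotients by zero, equal by convention. *)
have [->|sz] := eqVneq s (phi (s2 theta delta)).
  by rewrite subrr mulr0 !invr0 !mulr0.
field; rewrite ?k0 ?d0 ?l2n ?W0 ?l2n //=.
by rewrite subr_eq0 sz.
Qed.
End Uniformization.

(** * Elementary factors of E *)

Section Factors.
Variable K : fieldType.
Implicit Types (S a b c w : K).

(** Up to a factor that does not depend on [a] (namely [- S]), this is the
    quotient of the linear form [S - a] by its transform [S^-1 - a]. *)
Definition invfacK S a := (S - a) / (a * (S - a^-1)).

Lemma invfacK_Efun S a b : a != 0 -> b != 0 ->
  S - b != 0 -> S - a^-1 != 0 -> S - b^-1 != 0 ->
  b / a * ((S - a) * (S - b^-1)) / ((S - b) * (S - a^-1))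
  = invfacK S a / invfacK S b.
Proof.
rewrite /invfacK => a0 b0; set x := S - b; set y := S - a^-1; set z := S - b^-1.
by move=> x0 y0 z0; field; rewrite a0 b0 x0 y0 z0.
Qed.

Lemma invfacKV S a : S - a != 0 -> S - a^-1 != 0 -> a != 0 ->
  invfacK S a^-1 = (invfacK S a)^-1.
Proof.
rewrite /invfacK invrK; set x := S - a; set y := S - a^-1 => x0 y0 a0.
by field; rewrite a0 x0 y0.
Qed.

(** This is [g(S) / g(1/S)] for [g(S) = c (S - a) / (S - b)]. *)
Lemma homography_ratio S a b c : S != 0 -> a != 0 -> b != 0 -> c != 0 ->
  S - b != 0 -> S - a^-1 != 0 -> S - b^-1 != 0 ->
  c * ((S - a) / (S - b)) / (c * ((S^-1 - a) / (S^-1 - b)))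
  = invfacK S a / invfacK S b.
Proof.
move=> S0 a0 b0 c0 x0 y0 z0.
have -> : S^-1 - a = - a * (S - a^-1) / S by field; rewrite S0 a0.
have -> : S^-1 - b = - b * (S - b^-1) / S by field; rewrite S0 b0.
rewrite /invfacK; move: x0 y0 z0.
set x := S - b; set y := S - a^-1; set z := S - b^-1 => x0 y0 z0.
by field; rewrite !oppr_eq0 S0 a0 b0 c0 x0 y0 z0.
Qed.

(** As a function of [S], the difference [y(S) - y(a)] vanishes at [a] and
    [w^2 / a]. Its quotient by [y(1/S) - y(a)] has therefore the zeros [a],
    [w^2 / a] and the poles [1/a], [a / w^2]. *)
Lemma joukowski_ratio S a w b : S != 0 -> a != 0 -> w != 0 -> b != 0 ->
  S - a^-1 != 0 -> S - a / w ^+ 2 != 0 -> S - w ^+ 2 / a != 0 ->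
  b * (S / w + w / S - (a / w + w / a))
    / (b * (S^-1 / w + w / S^-1 - (a / w + w / a)))
  = invfacK S a / invfacK S (a / w ^+ 2).
Proof.
move=> S0 a0 w0 b0 x0 y0 z0.
have -> : S / w + w / S - (a / w + w / a) = (S - a) * (S - w ^+ 2 / a) / (S * w).
  by field; rewrite ?S0 ?a0 ?w0.
have -> : S^-1 / w + w / S^-1 - (a / w + w / a)
    = w ^+ 2 * (S - a^-1) * (S - a / w ^+ 2) / (S * w).
  by field; rewrite ?oner_neq0 ?S0 ?a0 ?w0.
rewrite /invfacK [(a / w ^+ 2)^-1]invf_div; move: x0 y0 z0; set d := S - a.
set x := S - a^-1; set y := S - a / w ^+ 2; set z := S - w ^+ 2 / a.
by move=> x0 y0 z0; field; rewrite S0 a0 w0 b0 x0 y0 z0.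
Qed.
End Factors.

Section RatfunFactors.
Context {R : realType}.
Local Notation C := R[i].
Implicit Types (a b : C).

Definition invfac a : ratfun R := invfacK rvar (rconst a).

Lemma invfac_neq0 a : a != 0 -> invfac a != 0.
Proof.
move=> a0; rewrite /invfac /invfacK -fmorphV.
by rewrite !mulf_neq0 ?invr_eq0 ?mulf_neq0 ?rvar_sub_neq0 ?fmorph_eq0.
Qed.

Lemma Efun_invfac a b : a != 0 -> b != 0 -> Efun a b = invfac a / invfac b.
Proof.
move=> a0 b0.
have r0 c : c != 0 -> rconst c != 0 :> ratfun R by rewrite fmorph_eq0.
rewrite /invfac -invfacK_Efun ?r0 ?rvar_sub_neq0 //.
- by rewrite /Efun fmorph_div !fmorphV.
- by rewrite -fmorphV rvar_sub_neq0.
- by rewrite -fmorphV rvar_sub_neq0.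
Qed.

Lemma invfacV a : a != 0 -> invfac a^-1 = (invfac a)^-1.
Proof.
move=> a0; rewrite /invfac fmorphV invfacKV ?rvar_sub_neq0 ?fmorph_eq0 //.
by rewrite -fmorphV rvar_sub_neq0.
Qed.

Lemma invfac_sign (e : bool) : invfac ((-1) ^+ e) ^+ 2 = 1.
Proof.
have e0 : (-1) ^+ e != 0 :> C by rewrite signr_eq0.
have eV : ((-1) ^+ e)^-1 = (-1) ^+ e :> C by rewrite -exprVn invrN1.
by rewrite expr2 -{1}eV (invfacV e0) mulVf // invfac_neq0.
Qed.
End RatfunFactors.

(** * Evaluation of rational functions at y(s) *)

Section EvaluationAtY.
Context {R : realType} {M : model R} {theta A B m : R}.
Hypotheses (nf : normal_form M theta A B m).
Local Notation C := R[i].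
Local Notation rc := (@rconst R).
Local Notation q := (q M).

Lemma qE : q = sqrtq M ^+ 2.
Proof. by rewrite /q mulr_natl mulr2n expiD -expr2. Qed.

Lemma sqrtq_neq0 : sqrtq M != 0.
Proof. exact: expi_neq0. Qed.

Lemma q_neq0 : q != 0.
Proof. exact: expi_neq0. Qed.

Lemma nonconst_yunif (K : fieldType) (phi : {rmorphism C -> K}) S :
  nonconst phi S -> nonconst phi (yunif M phi S).
Proof.
move=> hS.
have b0 : ((B / 2)%:C)%C / sqrtq M != 0.
  rewrite mulf_neq0 ?invr_eq0 ?sqrtq_neq0 // fmorph_eq0.
  by rewrite mulf_neq0 ?invr_eq0 ?pnatr_eq0 // gt_eqF // (nf_B nf).
suff -> : yunif M phi S = phi (((yplus M + yminus M) / 2)%:C)%C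
    + phi (((B / 2)%:C)%C / sqrtq M) * (S + phi q / S).
  exact: nonconst_joukowski b0 hS.
rewrite /yunif (nf_yamp nf); congr (_ + _).
rewrite [phi (_ / sqrtq M)]fmorph_div -mulrA; congr (_ * _).
have W0 : phi (sqrtq M) != 0 by rewrite fmorph_eq0 sqrtq_neq0.
rewrite qE rmorphXn; field.
by rewrite W0 (nonconst_neq0 hS).
Qed.

Lemma nonconst_xunif (K : fieldType) (phi : {rmorphism C -> K}) S :
  nonconst phi S -> nonconst phi (@xunif R K phi theta A S).
Proof.
move=> hS.
have a0 : ((A / 2)%:C)%C != 0 :> C.
  by rewrite fmorph_eq0 mulf_neq0 ?invr_eq0 ?pnatr_eq0 // gt_eqF // (nf_A nf).
have := @nonconst_joukowski R K phi S (A * cos theta)%:C%C _ 1 a0 hS.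
by rewrite rmorph1 mul1r.
Qed.

Lemma rmorph_yunif (K L : fieldType) (psi : {rmorphism K -> L}) (phi : C -> K)
    (phi' : C -> L) S : (forall c, psi (phi c) = phi' c) ->
  psi (yunif M phi S) = yunif M phi' (psi S).
Proof.
by move=> h; rewrite /yunif !(rmorphD, rmorphM, fmorphV) /= !h.
Qed.

Lemma rmorph_xunif (K L : fieldType) (psi : {rmorphism K -> L})
    (phi : {rmorphism C -> K}) (phi' : {rmorphism C -> L}) S :
  (forall c, psi (phi c) = phi' c) ->
  psi (@xunif R K phi theta A S) = @xunif R L phi' theta A (psi S).
Proof.
by move=> h; rewrite /xunif !(rmorphD, rmorphM, fmorphV) /= !h.
Qed.

Lemma rmorph_gquot (K L : fieldType) (psi : {rmorphism K -> L}) (f : R -> K)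
    (f' : R -> L) x y : (forall c, psi (f c) = f' c) ->
  psi (gquot f M x y) = gquot f' M (psi x) (psi y).
Proof.
by move=> h; rewrite /gquot /gamma1 /gamma2 !(rmorphD, rmorphM, fmorphV) /= !h.
Qed.

Lemma rmorph_ratfun_ext (K : fieldType) (f g : {rmorphism ratfun R -> K}) :
  (forall c, f (rconst c) = g (rconst c)) -> f rvar = g rvar ->
  forall h, f h = g h.
Proof.
move=> hc hx h; rewrite (rmorph_ratfunE f) (rmorph_ratfunE g) hx.
by congr (reval _ _ _); apply/funext.
Qed.

Lemma rmorph_comp_y (K : fieldType) (psi : {rmorphism ratfun R -> K})
    (F s : ratfun R) :
  psi (comp_y M F s) = reval (cemb psi) F (yunif M (cemb psi) (psi s)).
Proof.
by rewrite /comp_y (rmorph_reval psi rc) (@rmorph_yunif _ _ psi rc (cemb psi)).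
Qed.

Definition yquot (F : ratfun R) := comp_y M F rvar / comp_y M F rvar^-1.

Lemma comp_y_morphism s : nonconst rc s ->
  exists Y : {rmorphism ratfun R -> ratfun R},
  [/\ forall F, comp_y M F s = Y F, Y rvar = yunif M rc s
    & forall c, Y (rconst c) = rconst c].
Proof.
move=> /(@nonconst_yunif _ rc)/eval_morphism[Y [YE Yx Yc]].
by exists Y; split=> // F; rewrite YE.
Qed.

Lemma nonconst_rvarV : nonconst rc rvar^-1.
Proof. exact: (@nonconstV _ _ rc _ nonconst_rvar). Qed.

Lemma yquotM F G : yquot (F * G) = yquot F * yquot G.
Proof.
rewrite /yquot; have [Y [YE _ _]] := comp_y_morphism nonconst_rvar.
have [Z [ZE _ _]] := comp_y_morphism nonconst_rvarV.
by rewrite !YE !ZE !rmorphM mulf_div.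
Qed.

Lemma yquotV F : yquot F^-1 = (yquot F)^-1.
Proof.
rewrite /yquot; have [Y [YE _ _]] := comp_y_morphism nonconst_rvar.
have [Z [ZE _ _]] := comp_y_morphism nonconst_rvarV.
by rewrite !YE !ZE !fmorphV invrK invf_div mulrC.
Qed.

Lemma yquot1 : yquot 1 = 1.
Proof.
rewrite /yquot; have [Y [YE _ _]] := comp_y_morphism nonconst_rvar.
have [Z [ZE _ _]] := comp_y_morphism nonconst_rvarV.
by rewrite !YE !ZE !rmorph1 divr1.
Qed.

Lemma yunif_sub (K : fieldType) (phi : C -> K) (S a : K) :
  yunif M phi S - yunif M phi a
  = phi (((yplus M - yminus M) / 4)%:C)%C
    * (S / phi (sqrtq M) + phi (sqrtq M) / S
       - (a / phi (sqrtq M) + phi (sqrtq M) / a)).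
Proof. by rewrite /yunif opprD addrACA subrr add0r -mulrBr. Qed.

Lemma yquot_sub_yval (a : C) : a != 0 ->
  yquot (rvar - rconst (yval M a)) = invfac a / invfac (a / q).
Proof.
move=> a0; rewrite /yquot.
have [Y [YE Yx Yc]] := comp_y_morphism nonconst_rvar.
have [Z [ZE Zx Zc]] := comp_y_morphism nonconst_rvarV.
rewrite !YE !ZE !rmorphB Yx Zx Yc Zc.
have yE : rconst (yval M a) = yunif M rc (rconst a).
  exact: (@rmorph_yunif _ _ rc id rc).
have aqE : rconst (a / q) = rconst a / rconst (sqrtq M) ^+ 2.
  by rewrite qE fmorph_div rmorphXn.
rewrite yE !yunif_sub /invfac aqE.
apply: joukowski_ratio.
- exact: (nonconst_neq0 nonconst_rvar).
- by rewrite fmorph_eq0.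
- by rewrite fmorph_eq0 sqrtq_neq0.
- rewrite fmorph_eq0 fmorph_eq0 (nf_yamp nf).
  by rewrite mulf_neq0 ?invr_eq0 ?pnatr_eq0 // gt_eqF // (nf_B nf).
- by rewrite -fmorphV rvar_sub_neq0.
- by rewrite -aqE rvar_sub_neq0.
- by rewrite -invf_div -aqE -fmorphV rvar_sub_neq0.
Qed.
End EvaluationAtY.

(** * Explicit decoupling functions *)

Lemma cancel_squares (K : fieldType) (x y u v : K) :
  u != 0 -> v != 0 -> y != 0 ->
  (x / u / (y / v)) ^+ 2 * (u ^+ 2 / v ^+ 2) = (x / y) ^+ 2.
Proof. by move=> u0 v0 y0; field; rewrite u0 v0 y0. Qed.

Section Decouplers.
Context {R : realType} {M : model R} {theta A B m : R}.
Hypotheses (nf : normal_form M theta A B m).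
Local Notation C := R[i].
Local Notation rc := (@rconst R).
Local Notation q := (q M).
Local Notation Q := (@yquot R M).

Let yM := yquotM nf.
Let yV := yquotV nf.
Let y1 := yquot1 nf.

Lemma Frs_neq0 r (a : C) : Frs M r a != 0.
Proof.
case: r => n; rewrite /Frs prodf_seq_neq0; apply/allP => k _ /=.
  exact: rvar_sub_neq0.
by rewrite invr_eq0 rvar_sub_neq0.
Qed.

Lemma fee_neq0 e eps : fee M e eps != 0.
Proof. by case: e; rewrite /fee ?oner_neq0 ?rvar_sub_neq0. Qed.

(** Each factor [y - y(a q^-j)] contributes [phi_(a q^-j) / phi_(a q^-(j+1))], so
    that the product telescopes; for [r < 0] the factors [1 / (y - y(a q^j))]
    telescope in the other direction. *)
Lemma yquot_Frs r (a : C) : a != 0 ->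
  Q (Frs M r a) = invfac a / invfac (a / q ^ r).
Proof.
move=> a0; have q0 := @q_neq0 R M.
have aq0 n : a * q ^+ n != 0 by rewrite mulf_neq0 ?expf_neq0.
have aqV0 n : a * q ^- n != 0 by rewrite mulf_neq0 ?invr_eq0 ?expf_neq0.
have aqE n : a * q ^+ n.+1 / q = a * q ^+ n by rewrite exprSr mulrA mulfK.
case: r => n /=.
  rewrite -exprnP /Frs; elim: n => [|n IH].
    by rewrite big_nil y1 expr0 invr1 mulr1 divff ?invfac_neq0.
  rewrite big_nat_recr //= yM IH (yquot_sub_yval nf) //.
  have -> : a / q ^+ n / q = a / q ^+ n.+1 by rewrite -mulrA -invfM -exprSr.
  by rewrite mulrA divfK ?invfac_neq0.
rewrite -[q ^ Negz n]/(q ^- n.+1) invrK; elim: n => [|n IH].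
  rewrite big_nat1 yV (yquot_sub_yval nf) // aqE expr0 mulr1.
  by rewrite invf_div.
rewrite big_nat_recr //= yM IH yV (yquot_sub_yval nf) // aqE.
by rewrite invf_div mulrA divfK ?invfac_neq0.
Qed.

(** For [tau = +- w] one has [tau / q = 1 / tau], and [phi_(1/a) = 1 / phi_a];
    for [tau = +- 1] the square is [1]. *)
Lemma yquot_fee e eps :
  Q (fee M e eps) = invfac ((-1) ^+ eps * sqrtq M ^+ e) ^+ 2.
Proof.
case: e; last by rewrite /fee y1 expr0 mulr1 invfac_sign.
have t0 : (-1) ^+ eps * sqrtq M != 0 by rewrite mulf_neq0 ?signr_eq0 ?sqrtq_neq0.
rewrite /fee (yquot_sub_yval nf) // expr1.
have -> : (-1) ^+ eps * sqrtq M / q = ((-1) ^+ eps * sqrtq M)^-1.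
  rewrite qE [RHS]invfM -[((-1) ^+ eps)^-1]exprVn invrN1 -mulrA; congr (_ * _).
  by rewrite expr2 invfM mulrA divff ?mul1r ?sqrtq_neq0.
by rewrite invfacV // invrK expr2.
Qed.

Lemma E_eq_F_Frs (delta epsilon : R) (r : int) :
  s1 M theta epsilon / s2 theta delta = q ^ r ->
  E_eq_F M theta delta epsilon 1 (Frs M r (s1 M theta epsilon)).
Proof.
move=> h; split; first exact: Frs_neq0.
have z10 : s1 M theta epsilon != 0 by rewrite oppr_eq0 expi_neq0.
have z20 : s2 theta delta != 0 by rewrite oppr_eq0 expi_neq0.
have z2E : s1 M theta epsilon / (s1 M theta epsilon / s2 theta delta)
    = s2 theta delta by rewrite invf_div mulrC divfK.
rewrite expr1 -[RHS]/(Q _) yquot_Frs // -h z2E.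
exact: Efun_invfac.
Qed.

Lemma E_eq_F_Frs_fee (delta epsilon : R) (r1 r2 : int) (e1 e2 eps1 eps2 : bool) :
  s1 M theta epsilon = (-1) ^+ eps1 * sqrtq M ^+ e1 * q ^ r1 ->
  s2 theta delta = (-1) ^+ eps2 * sqrtq M ^+ e2 * q ^ r2 ->
  E_eq_F M theta delta epsilon 2
    ((Frs M r1 (s1 M theta epsilon) / Frs M r2 (s2 theta delta)) ^+ 2
      * (fee M e1 eps1 / fee M e2 eps2)).
Proof.
move=> h1 h2; have Frs0 := Frs_neq0; have fee0 := fee_neq0.
split.
  apply: mulf_neq0; first by apply: expf_neq0; apply: mulf_neq0; rewrite ?invr_eq0.
  by apply: mulf_neq0; rewrite ?invr_eq0.
have z10 : s1 M theta epsilon != 0 by rewrite oppr_eq0 expi_neq0.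
have z20 : s2 theta delta != 0 by rewrite oppr_eq0 expi_neq0.
have yX F : Q (F ^+ 2) = Q F ^+ 2 by rewrite !expr2 yM.
rewrite -[RHS]/(Q _) yM yX !(yM, yV) !yquot_Frs // !yquot_fee.
have qr r : q ^ r != 0 by rewrite expfz_neq0 // q_neq0.
have tau0 (e eps : bool) : (-1) ^+ eps * sqrtq M ^+ e != 0.
  by rewrite mulf_neq0 ?signr_eq0 // expf_neq0 // sqrtq_neq0.
rewrite [in invfac (s1 M theta epsilon / _)]h1 [in invfac (s2 theta delta / _)]h2.
rewrite !mulfK // /E Efun_invfac //.
by rewrite cancel_squares // invfac_neq0.
Qed.
End Decouplers.

(** * Cancellation of zeros and poles in q-orbits *)

Section Orbits.
Context {R : realType}.
Local Notation C := R[i].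

Lemma orbdeg_Efun (O : pred C) (a b : C) : a != 0 -> b != 0 ->
  orbdeg O (Efun a b) = (O a : nat)%:Z + (O b^-1 : nat)%:Z
    - ((O b : nat)%:Z + (O a^-1 : nat)%:Z).
Proof.
move=> a0 b0; have s0 := @rvar_sub_neq0 R.
have sM u v : (rvar - rconst u) * (rvar - rconst v) != 0 :> ratfun R.
  exact: mulf_neq0.
have c0 : b / a != 0 by rewrite mulf_neq0 ?invr_eq0.
have rc0 : rconst (b / a) != 0 by rewrite fmorph_eq0.
have d0 : ((rvar - rconst b) * (rvar - rconst a^-1))^-1 != 0 :> ratfun R.
  by rewrite invr_eq0 sM.
rewrite /Efun (orbdegM _ (mulf_neq0 rc0 (sM a b^-1)) d0).
rewrite (orbdegM _ rc0 (sM _ _)) (orbdegV _ (sM _ _)) (orbdeg_rconst _ c0) add0r.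
by rewrite (orbdegM _ (s0 _) (s0 _)) (orbdegM _ (s0 _) (s0 _)) !orbdeg_rvar_sub.
Qed.

Lemma Efun_neq0 (a b : C) : a != 0 -> b != 0 -> Efun a b != 0.
Proof.
move=> a0 b0; have fb : (invfac b)^-1 != 0 by rewrite invr_eq0 invfac_neq0.
by rewrite (Efun_invfac a0 b0) (mulf_neq0 (invfac_neq0 a0) fb).
Qed.

(** The zeros [a], [1/b] and poles [b], [1/a] of [Efun a b] balance in every
    orbit.  If [a] and [b] are in different orbits, then the orbit of [a] has to
    contain the pole [1/a], and the orbit of [b] the zero [1/b]. *)
Lemma orbit_cancellation (k a b : C) (n : nat) (H : ratfun R) :
  k != 0 -> a != 0 -> b != 0 -> (0 < n)%N -> H != 0 ->
  Efun a b ^+ n = reval (@rconst R) H rvar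
    / reval (@rconst R) H (rconst k * rvar) ->
  (exists r : int, a / b = k ^ r) \/
  ((exists r : int, a ^+ 2 = k ^ r) /\ (exists r : int, b ^+ 2 = k ^ r)).
Proof.
move=> k0 a0 b0 n0 H0 EH.
pose O w : pred C := fun z => `[< exists r : int, z = w * k ^ r >].
have Ok w z : O w (k * z) = O w z.
  apply/asboolP/asboolP => -[r E].
    exists (r - 1); rewrite expfzDr // exprN1; apply: (mulfI k0).
    by rewrite E mulrCA [k * _]mulrC mulfVK.
  by exists (1 + r); rewrite E expfzDr // expr1z mulrCA.
have Oxx w : O w w by apply/asboolP; exists 0; rewrite expr0z mulr1.
have deg0 w : ((O w a : nat) + (O w b^-1 : nat)
    = (O w b : nat) + (O w a^-1 : nat))%N.
  have E0 := Efun_neq0 a0 b0.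
  have /(congr1 (orbdeg (O w))) := EH.
  have Hk0 : reval (@rconst R) H (rconst k * rvar) != 0.
    apply/eqP => Hk; move: EH; rewrite Hk invr0 mulr0 => /eqP.
    by rewrite expf_eq0 (negPf E0) andbF.
  have HkV0 : (reval (@rconst R) H (rconst k * rvar))^-1 != 0.
    by rewrite invr_eq0 Hk0.
  rewrite reval_rvar (orbdegX _ _ E0) (orbdegM _ H0 HkV0) (orbdegV _ Hk0).
  rewrite (orbdeg_dilate k0 (Ok w) H0) subrr (orbdeg_Efun _ a0 b0) => /eqP.
  rewrite mulrn_eq0 -[n == 0]negbK -lt0n n0 /= subr_eq0 -!PoszD.
  by rewrite eqz_nat => /eqP.
have get w z : w != 0 -> O w z -> exists r : int, z / w = k ^ r.
  by move=> w0 /asboolP[r ->]; exists r; rewrite mulrAC divff // mul1r.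
have sqr w : w != 0 -> O w w^-1 -> exists r : int, w ^+ 2 = k ^ r.
  move=> w0 /(get _ _ w0)[r E]; exists (- r).
  by rewrite -invr_expz -E -invfM invrK expr2.
case Oba : (O b a); first by left; apply: get.
case Oab : (O a b).
  left; have [r E] := get _ _ a0 Oab; exists (- r).
  by rewrite -invr_expz -E invf_div.
right; split; apply: sqr => //.
  by have := deg0 a; rewrite Oxx Oab; case: (O a a^-1) => //; case: (O a b^-1).
by have := deg0 b; rewrite Oxx Oba; case: (O b b^-1) => //; case: (O b a^-1).
Qed.
End Orbits.

(** * From powers of q to congruences between angles *)

Section Angles.
Context {R : realType} {M : model R} {theta delta epsilon : R}.
Hypothesis b0 : beta M != 0.
Local Notation z1 := (s1 M theta epsilon).
Local Notation z2 := (s2 theta delta).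

Lemma in_ZpibetaZ_div (x : R) : in_ZpibetaZ M (x / beta M) <->
  exists a b : int, x = a%:~R * beta M + pi * b%:~R.
Proof.
split=> -[a [b E]]; exists a, b; last by rewrite E; field.
by rewrite -[LHS](divfK b0) E; field.
Qed.

Lemma expi_q_pow (x : R) : (exists r : int, expi x = q M ^ r) <->
  exists r k : int, x = 2 * (r%:~R * beta M + pi * k%:~R).
Proof.
split=> [[r]|[r [k E]]].
  rewrite /q -expi_mulz => /expi_inj_2pi[k E]; exists r, k.
  by rewrite E; ring.
exists r; rewrite /q -expi_mulz; apply/expi_inj_2pi; exists k.
by rewrite E; ring.
Qed.

Lemma in_ZpibetaZ_alpha : in_ZpibetaZ M (alpha M delta epsilon) <->
  exists r : int, z1 / z2 = q M ^ r.
Proof.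
have -> : z1 / z2 = expi (2 * (beta M - epsilon - delta)).
  rewrite /s1 /s2 invrN mulrNN -expiN -expiD; congr expi; ring.
rewrite expi_q_pow in_ZpibetaZ_div; split=> -[a [b E]].
  exists (1 - a), (- b - 1); rewrite !intrD !mulrNz; congr (_ * _).
  have -> : epsilon = a%:~R * beta M + pi * b%:~R + pi - delta.
    by rewrite -E; ring.
  ring.
exists (1 - a), (- b - 1); rewrite !intrD !mulrNz.
have {}E : beta M - epsilon - delta = a%:~R * beta M + pi * b%:~R.
  by apply: (mulfI _ E); rewrite pnatr_eq0.
have -> : epsilon = beta M - delta - (a%:~R * beta M + pi * b%:~R).
  by rewrite -E; ring.
ring.
Qed.

Lemma in_ZpibetaZ_alpha1 : in_ZpibetaZ M (alpha1 M theta epsilon) <->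
  exists r : int, z1 ^+ 2 = q M ^ r.
Proof.
have -> : z1 ^+ 2 = expi (2 * (2 * beta M - 2 * epsilon - theta)).
  by rewrite /s1 sqrrN expr2 -expiD; congr expi; ring.
rewrite expi_q_pow in_ZpibetaZ_div; split=> -[a [b E]].
  exists (1 - a), (- b - 1); rewrite !intrD !mulrNz; congr (_ * _).
  have -> : theta = a%:~R * beta M + pi * b%:~R + pi + beta M - 2 * epsilon.
    by rewrite -E; ring.
  ring.
exists (1 - a), (- b - 1); rewrite !intrD !mulrNz.
have {}E : 2 * beta M - 2 * epsilon - theta = a%:~R * beta M + pi * b%:~R.
  by apply: (mulfI _ E); rewrite pnatr_eq0.
have -> : theta = 2 * beta M - 2 * epsilon - (a%:~R * beta M + pi * b%:~R).
  by rewrite -E; ring.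
ring.
Qed.

Lemma in_ZpibetaZ_alpha2 : in_ZpibetaZ M (alpha2 M theta delta) <->
  exists r : int, z2 ^+ 2 = q M ^ r.
Proof.
have -> : z2 ^+ 2 = expi (2 * (2 * delta - theta)).
  by rewrite /s2 sqrrN expr2 -expiD; congr expi; ring.
rewrite expi_q_pow in_ZpibetaZ_div; split=> -[a [b E]].
  exists a, (b + 1); rewrite !intrD; congr (_ * _).
  have -> : theta = 2 * delta - pi - (a%:~R * beta M + pi * b%:~R).
    by rewrite -E; ring.
  ring.
exists a, (b - 1); rewrite !intrD !mulrNz.
have {}E : 2 * delta - theta = a%:~R * beta M + pi * b%:~R.
  by apply: (mulfI _ E); rewrite pnatr_eq0.
have -> : theta = 2 * delta - (a%:~R * beta M + pi * b%:~R) by rewrite -E; ring.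
ring.
Qed.

(** A square root of [q^r] is [+- w^r]; divide [r] by [2]. *)
Lemma sqrt_q_pow (z : R[i]) (r : int) : z ^+ 2 = q M ^ r ->
  exists (k : int) (e eps : bool),
    z = (-1) ^+ eps * sqrtq M ^+ e * q M ^ k.
Proof.
have w0 : sqrtq M != 0 := expi_neq0 _.
have qZ (k : int) : q M ^ k = (sqrtq M ^ k) ^+ 2.
  by rewrite qE !exprnP !exprz_exp mulrC.
rewrite qZ => /eqP; rewrite eqf_sqr => /orP h.
have [k [e rE]] : exists (k : int) (e : bool), r = e%:Z + k * 2.
  exists (r %/ 2)%Z, ((r %% 2)%Z == 1).
  have mb : (0 <= (r %% 2)%Z < 2)%R by rewrite modz_ge0 //= ltz_pmod.
  rewrite [LHS](divz_eq r 2) addrC; congr (_ + _).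
  by move: mb; case: (r %% 2)%Z => // -[|[|]].
have wE : sqrtq M ^ r = sqrtq M ^+ e * q M ^ k.
  by rewrite rE expfzDr // -exprnP qZ [(_ ^ k) ^+ 2]exprnP exprz_exp.
exists k, e; case: h => /eqP ->.
  by exists false; rewrite expr0 mul1r.
by exists true; rewrite expr1 wE mulN1r mulNr.
Qed.
End Angles.

(** * Decoupling pairs and the equation for E *)

Section FieldIdentities.
Variable K : fieldType.
Implicit Types (a b c d S T : K).

Lemma divf_div_cancel a b c : c != 0 -> a / c / (b / c) = a / b.
Proof.
by move=> c0; rewrite invf_div mulf_div [c * b]mulrC -mulf_div divff ?mulr1.
Qed.

Lemma affine_cancel a b c : b != 0 -> (a + b * c - a) / b = c.
Proof. by move=> b0; rewrite addrAC subrr add0r mulrC mulKf. Qed.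

Lemma cross_quotient a b c d : a != 0 -> b != 0 -> d != 0 ->
  d / b = c / a -> a / b = c / d.
Proof.
move=> a0 b0 d0 E; have -> : c = d / b * a by rewrite E divfK.
by field; rewrite b0 d0.
Qed.

Lemma joukowski_fiber S T : S != 0 -> T != 0 ->
  S + S^-1 = T + T^-1 -> S = T \/ T = S^-1.
Proof.
move=> S0 T0 E; have : (S - T) * (T - S^-1) = 0.
  rewrite [LHS](_ : _ = T * ((S + S^-1) - (T + T^-1))); last by field; rewrite S0 T0.
  by rewrite E subrr mulr0.
by move=> /eqP; rewrite mulf_eq0 !subr_eq0 => /orP[]/eqP; [left|right].
Qed.

(** [y] is invariant under [s |-> w^2 / s]. *)
Lemma yunif_reflect (R : realType) (M : model R) (phi : R[i] -> K) S :
  S != 0 -> phi (sqrtq M) != 0 ->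
  yunif M phi S^-1 = yunif M phi (phi (sqrtq M) ^+ 2 * S).
Proof.
move=> S0 W0; rewrite /yunif; congr (_ + _ * _).
by field; rewrite ?S0 ?W0 ?oner_neq0.
Qed.
End FieldIdentities.

Section Decoupling.
Context {R : realType} {M : model R} {theta delta epsilon A B m : R}.
Hypotheses (nf : normal_form M theta A B m) (sb0 : 0 < sin (beta M)).
Hypotheses (r1 : 0 < r11 M) (r2 : 0 < r22 M).
Hypotheses (he : is_epsilon M epsilon) (hd : is_delta M delta).
Local Notation C := R[i].
Local Notation rc := (@rconst R).
Local Notation ratfun := (ratfun R).
Local Notation E := (E M theta delta epsilon).

Definition x_s : ratfun := @xunif R _ rc theta A rvar.
Definition y_s : ratfun := yunif M rc rvar.
Definition g_s : ratfun := gquot (embR rc) M x_s y_s.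

Lemma inversion_morphism :
  exists inv : {rmorphism ratfun -> ratfun},
    (forall c, inv (rconst c) = rconst c) /\ inv rvar = rvar^-1.
Proof.
have [inv [_ ix ic]] := eval_morphism (@nonconst_rvarV R).
by exists inv.
Qed.

Section Inversion.
Variable inv : {rmorphism ratfun -> ratfun}.
Hypotheses (ic : forall c, inv (rconst c) = rconst c)
  (ix : inv rvar = rvar^-1).

Lemma inv_x : inv x_s = x_s.
Proof.
rewrite (rmorph_xunif (phi' := rc)) // ix /x_s /xunif invrK.
by rewrite [_^-1 + _]addrC.
Qed.

Lemma inv_comp_y F : inv (comp_y M F rvar) = comp_y M F rvar^-1.
Proof.
rewrite rmorph_comp_y ix /comp_y.
by have -> : cemb inv = rc by apply/funext.
Qed.

Lemma g_quotient : g_s / inv g_s = E.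
Proof.
have [c c0 gE] := gquot_unif rc nf sb0 r1 r2 he hd.
have s0 : rvar != 0 :> ratfun := nonconst_neq0 nonconst_rvar.
have sT : rvar + rconst (expi theta) != 0 :> ratfun.
  by rewrite -[rconst _]opprK -rmorphN rvar_sub_neq0.
have gsE := gE _ s0 sT.
have z10 : s1 M theta epsilon != 0 by rewrite oppr_eq0 expi_neq0.
have z20 : s2 theta delta != 0 by rewrite oppr_eq0 expi_neq0.
have sub0 := @rvar_sub_neq0 R.
have -> : g_s = rconst c * ((rvar - rconst (s1 M theta epsilon))
    / (rvar - rconst (s2 theta delta))) by exact: gsE.
rewrite rmorphM ic fmorph_div !rmorphB ix !ic.
rewrite /Defs.E (Efun_invfac z10 z20).
apply: homography_ratio.
- exact: s0.
- by rewrite fmorph_eq0 z10.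
- by rewrite fmorph_eq0 z20.
- by rewrite fmorph_eq0 c0.
- exact: sub0.
- by rewrite -fmorphV sub0.
- by rewrite -fmorphV sub0.
Qed.
End Inversion.

(** A branch [Y] of the algebraic function [Y(x)] has a parameter [S] in [K],
    which is not a constant because [x] is not one; the morphism is evaluation
    at [S]. *)
Lemma kernel_point (K : fieldType) (iota : {rmorphism ratfun -> K}) (Y : K) :
  gamma (remb iota) M (iota rvar) Y = 0 ->
  exists psi : {rmorphism ratfun -> K},
    [/\ forall c, psi (rconst c) = iota (rconst c), psi x_s = iota rvar,
      psi y_s = Y, nonconst (cemb iota) (psi rvar)
      & forall F, psi (comp_y M F rvar) = reval (cemb iota) F Y].
Proof.
pose phi : {rmorphism C -> K} := iota \o rc.
move=> /(gamma_eq0_unif nf sb0 (phi := phi))[S [S0 xE yE]].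
have hS : nonconst phi S.
  move=> c; apply/eqP => Sc; move: xE; rewrite Sc /xunif -fmorphV.
  rewrite -rmorphD -rmorphM -rmorphD => /fmorph_inj/eqP.
  by rewrite (negPf (nonconst_rvar _)).
have [psi [_ px pc]] := eval_morphism hS.
have psiy : psi y_s = Y.
  by rewrite yE /y_s (@rmorph_yunif _ _ _ _ psi rc phi) // px.
exists psi; split=> //.
- by rewrite xE /x_s (@rmorph_xunif _ _ _ _ _ psi rc phi) // px.
- by rewrite px.
move=> F; rewrite rmorph_comp_y.
have -> : cemb psi = cemb iota by apply/funext.
congr (reval _ F _); rewrite -psiy /y_s.
by rewrite (@rmorph_yunif _ _ _ _ psi rc (cemb iota)).
Qed.

Lemma rmorph_g (K : fieldType) (iota psi : {rmorphism ratfun -> K}) Y :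
  (forall c, psi (rconst c) = iota (rconst c)) ->
  psi x_s = iota rvar -> psi y_s = Y ->
  psi g_s = gquot (remb iota) M (iota rvar) Y.
Proof. by move=> pc <- <-; apply: rmorph_gquot => c; exact: pc. Qed.

Lemma x_s_morphism : exists chi : {rmorphism ratfun -> ratfun},
  (forall c, chi (rconst c) = rconst c) /\ chi rvar = x_s.
Proof.
have hx : nonconst rc x_s := @nonconst_xunif _ _ _ _ _ _ nf _ rc _ nonconst_rvar.
by have [chi [_ cx cc]] := eval_morphism hx; exists chi.
Qed.

Lemma gamma_x_y_s : gamma (embR rc) M x_s y_s = 0.
Proof. exact: gamma_unif nf _ (nonconst_neq0 nonconst_rvar). Qed.

Lemma E_neq0 : E != 0.
Proof. by apply: Efun_neq0; rewrite oppr_eq0 expi_neq0. Qed.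

Lemma comp_y_neq0 F s : nonconst rc s -> F != 0 -> comp_y M F s != 0.
Proof.
move=> hs F0; have [Y [YE _ _]] := comp_y_morphism nf hs.
by rewrite YE fmorph_eq0.
Qed.

(** Apply the decoupling identity to the branch [y(s)] in [K = C(s)], and divide
    by its image under inversion, which leaves [L(x(s))] unchanged. *)
Lemma E_eq_F_of_pair n F L :
  decoupling_pair M n F L -> E_eq_F M theta delta epsilon n F.
Proof.
case=> F0 L0 dec; split=> //.
have [inv [ic ix]] := inversion_morphism.
have [chi [cc cx]] := x_s_morphism.
have cE : cemb chi = rc by apply/funext.
have rE : remb chi = embR rc :> (R -> ratfun) by apply/funext => c; exact: cc.
have := dec _ chi y_s; rewrite rE cE cx => /(_ gamma_x_y_s) gE.
have chiI : inv (chi L) = chi L.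
  have := @rmorph_ratfun_ext _ _ (inv \o chi : {rmorphism ratfun -> ratfun}) chi.
  by apply=> [c|] /=; rewrite ?cc ?ic // cx inv_x.
have := congr1 inv gE; rewrite fmorph_div chiI.
have -> : reval rc F y_s = comp_y M F rvar by [].
rewrite (inv_comp_y ic ix) => gE'.
rewrite -(g_quotient ic ix) [LHS]expr_div_n -rmorphXn gE' [g_s ^+ n]gE.
have cL0 : chi L != 0 by rewrite fmorph_eq0 L0.
by rewrite -[reval rc F y_s]/(comp_y M F rvar) divf_div_cancel.
Qed.

(** The function [L(x(s))] is [F(y(s)) / g(s)^n], which is invariant
    under inversion because [E(s) = g(s) / g(1/s)]. *)
Lemma pair_of_E_eq_F n F : E_eq_F M theta delta epsilon n F ->
  exists L, decoupling_pair M n F L.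
Proof.
case=> F0 EF.
have [inv [ic ix]] := inversion_morphism.
have [chi [cc cx]] := x_s_morphism.
have Fy0 : comp_y M F rvar != 0 := comp_y_neq0 nonconst_rvar F0.
have g0 : g_s != 0.
  apply/eqP => g0; have := E_neq0.
  by rewrite -(g_quotient ic ix) g0 mul0r eqxx.
have gn0 : g_s ^+ n != 0 by rewrite expf_neq0.
pose f := comp_y M F rvar / g_s ^+ n.
have fI : inv f = f.
  have ign0 : inv g_s ^+ n != 0 by rewrite -rmorphXn fmorph_eq0 gn0.
  rewrite /f fmorph_div rmorphXn (inv_comp_y ic ix).
  apply: (cross_quotient (comp_y_neq0 (@nonconst_rvarV R) F0) ign0 gn0).
  by rewrite -EF -(g_quotient ic ix) [RHS]expr_div_n.
have [v cv] : exists v, chi v = rvar + rvar^-1.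
  exists ((rvar - rconst ((A * cos theta)%:C)%C) / rconst ((A / 2)%:C)%C).
  rewrite fmorph_div rmorphB cx !cc; apply: affine_cancel.
  rewrite fmorph_eq0 fmorph_eq0 mulf_neq0 ?invr_eq0 ?pnatr_eq0 //.
  by rewrite gt_eqF // (nf_A nf).
have chiI L : inv (chi L) = chi L.
  have := @rmorph_ratfun_ext _ _ (inv \o chi : {rmorphism ratfun -> ratfun}) chi.
  by apply=> [c|] /=; rewrite ?cc ?ic // cx inv_x.
have [L fL] := invariant_descent cc chiI ix cv fI.
have gV0 : (g_s ^+ n)^-1 != 0 by rewrite invr_eq0 gn0.
have f0 : f != 0 := mulf_neq0 Fy0 gV0.
exists L; split; first exact: F0.
  by apply/eqP => L0; move: f0; rewrite fL L0 rmorph0 eqxx.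
move=> K iota Y /kernel_point[psi [pc px py _ pF]].
rewrite -(rmorph_g pc px py) -rmorphXn -pF.
have -> : iota L = psi (chi L).
  have := @rmorph_ratfun_ext _ _ iota (psi \o chi : {rmorphism ratfun -> K}).
  by apply=> [c|] /=; rewrite ?cc ?pc // cx px.
by rewrite -fL -fmorph_div /f divKf.
Qed.

Lemma xunif_cancel (K : fieldType) (phi : {rmorphism C -> K}) S T :
  @xunif R K phi theta A S = @xunif R K phi theta A T ->
  S + S^-1 = T + T^-1.
Proof.
rewrite /xunif => /addrI/mulfI; apply.
rewrite fmorph_eq0 fmorph_eq0 mulf_neq0 ?invr_eq0 ?pnatr_eq0 //.
by rewrite gt_eqF // (nf_A nf).
Qed.

(** The parameters of two branches over the same [x] satisfy
    [S + 1/S = S' + 1/S'], and [S' = S] would make the branches equal. *)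
Lemma decoupling_function_of_E_eq_F n F : E_eq_F M theta delta epsilon n F ->
  decoupling_function M n F.
Proof.
case=> F0 EF; split=> [|K iota Ym Yp]; first exact: F0.
move=> /kernel_point[psi [pc px py pn pF]].
move=> /kernel_point[psi' [pc' px' py' pn' pF']] neY.
have [inv [ic ix]] := inversion_morphism.
pose phi : {rmorphism C -> K} := iota \o rc.
have S0 : psi rvar != 0 by rewrite fmorph_eq0 (nonconst_neq0 nonconst_rvar).
have S0' : psi' rvar != 0 by rewrite fmorph_eq0 (nonconst_neq0 nonconst_rvar).
have ext : psi' rvar = psi rvar -> False.
  move=> e; move: neY; rewrite -py -py'.
  rewrite (@rmorph_ratfun_ext _ _ psi psi') ?eqxx // => c.
  by rewrite pc pc'.
have xx : psi rvar + (psi rvar)^-1 = psi' rvar + (psi' rvar)^-1.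
  apply: (xunif_cancel (phi := phi)).
  rewrite -(@rmorph_xunif _ _ _ _ _ psi rc phi) //.
  by rewrite -(@rmorph_xunif _ _ _ _ _ psi' rc phi) // -/x_s px px'.
have S'E : psi' rvar = (psi rvar)^-1.
  case: (joukowski_fiber S0 S0' xx) => // e; by case: (ext (esym e)).
have psi'E h : psi' h = psi (inv h).
  have := @rmorph_ratfun_ext _ _ psi' (psi \o inv : {rmorphism ratfun -> K}).
  by apply=> [c|] /=; rewrite ?ic ?pc ?pc' // ix fmorphV.
rewrite -(rmorph_g pc px py) -(rmorph_g pc' px' py') -pF -pF' !psi'E.
rewrite -!rmorphXn -!fmorph_div (inv_comp_y ic ix) -EF; congr (psi _).
by rewrite rmorphXn -[LHS]expr_div_n (g_quotient ic ix).
Qed.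

Lemma E_eq_H_of_E_eq_F n F : E_eq_F M theta delta epsilon n F ->
  E_eq_H M theta delta epsilon n (comp_y M F rvar).
Proof.
case=> F0 EF; split; first exact: comp_y_neq0 nonconst_rvar F0.
have qn : nonconst rc (rconst (q M) * rvar).
  have := @nonconst_joukowski R _ rc rvar 0 (q M) 0 (@q_neq0 R M) nonconst_rvar.
  by rewrite !rmorph0 add0r mul0r addr0.
have [dil [dE dx dc]] := eval_morphism qn.
rewrite EF reval_rvar -dE rmorph_comp_y dx.
have -> : cemb dil = rc by apply/funext.
congr (_ / reval _ F _).
have s0 : rvar != 0 :> ratfun := nonconst_neq0 nonconst_rvar.
have W0 : rconst (sqrtq M) != 0 :> ratfun by rewrite fmorph_eq0 sqrtq_neq0.
have -> : rconst (q M) = rconst (sqrtq M) ^+ 2 by rewrite qE rmorphXn.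
by rewrite (yunif_reflect s0 W0).
Qed.
End Decoupling.

Unset Implicit Arguments.

Theorem theorem6p6 (R : realType) (M : model R) (theta delta epsilon : R)
  (Sigma_posdef : sym_posdef (Sigma M))
  (r11_gt0 : 0 < r11 M) (r22_gt0 : 0 < r22 M)
  (mu1_lt0 : mu1 M < 0) (mu2_lt0 : mu2 M < 0)
  (det_refl : 0 < \det (refl M))
  (stab1 : r22 M * mu1 M - r12 M * mu2 M < 0)
  (stab2 : r11 M * mu2 M - r21 M * mu1 M < 0)
  (theta_def : is_theta M theta)
  (delta_def : is_delta M delta)
  (epsilon_def : is_epsilon M epsilon) :
  let a := alpha M delta epsilon in
  let a1 := alpha1 M theta epsilon in
  let a2 := alpha2 M theta delta in
  let z1 := s1 M theta epsilon in
  let z2 := s2 theta delta in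
  let has_pair := exists (m : nat) (F L : ratfun R),
    (0 < m)%N /\ decoupling_pair M m F L in
  let cond1 := exists (m : nat) (F : ratfun R),
    (0 < m)%N /\ E_eq_F M theta delta epsilon m F in
  let cond2 := exists (m : nat) (H : ratfun R),
    (0 < m)%N /\ E_eq_H M theta delta epsilon m H in
  let cond3 := in_ZpibetaZ M a \/ (in_ZpibetaZ M a1 /\ in_ZpibetaZ M a2) in
  ((has_pair <-> cond1) /\ (has_pair <-> cond2) /\ (has_pair <-> cond3))
  /\ (forall (m : nat) (F : ratfun R), (0 < m)%N ->
        E_eq_F M theta delta epsilon m F -> decoupling_function M m F)
  /\ (in_ZpibetaZ M a -> forall r : int, z1 / z2 = q M ^ r ->
        E_eq_F M theta delta epsilon 1 (Frs M r z1))
  /\ (in_ZpibetaZ M a1 -> in_ZpibetaZ M a2 ->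
      forall (r1 r2 : int) (e1 e2 eps1 eps2 : bool),
        z1 = (-1) ^+ eps1 * sqrtq M ^+ e1 * q M ^ r1 ->
        z2 = (-1) ^+ eps2 * sqrtq M ^+ e2 * q M ^ r2 ->
        E_eq_F M theta delta epsilon 2
          ((Frs M r1 z1 / Frs M r2 z2) ^+ 2 * (fee M e1 eps1 / fee M e2 eps2))).
Proof.
move=> a a1 a2 z1 z2 has_pair cond1 cond2 cond3.
have [sb0 [A [B [m nf]]]] := normal_formP Sigma_posdef mu2_lt0 theta_def.
have b0 : beta M != 0.
  by apply/eqP => b0; move: sb0; rewrite b0 sin0 ltxx.
have z10 : z1 != 0 by rewrite oppr_eq0 expi_neq0.
have z20 : z2 != 0 by rewrite oppr_eq0 expi_neq0.
have pair_1 : has_pair -> cond1.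
  move=> [n [F [L [n0 FL]]]]; exists n, F; split=> //.
  exact: E_eq_F_of_pair nf sb0 r11_gt0 r22_gt0 epsilon_def delta_def _ _ _ FL.
have pair_of_1 : cond1 -> has_pair.
  move=> [n [F [n0 EF]]].
  have [L FL] :=
    pair_of_E_eq_F nf sb0 r11_gt0 r22_gt0 epsilon_def delta_def EF.
  by exists n, F, L.
have one_2 : cond1 -> cond2.
  move=> [n [F [n0 EF]]]; exists n, (comp_y M F rvar); split=> //.
  exact: E_eq_H_of_E_eq_F nf _ _ EF.
have two_3 : cond2 -> cond3.
  move=> [n [H [n0 [H0 EH]]]].
  have [h|[h1 h2]] := orbit_cancellation (@q_neq0 R M) z10 z20 n0 H0 EH.
    by left; apply/(in_ZpibetaZ_alpha (theta := theta) b0).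
  by right; split; [apply/(in_ZpibetaZ_alpha1 b0)|apply/(in_ZpibetaZ_alpha2 b0)].
have three_1 : cond3 -> cond1.
  case=> [/(in_ZpibetaZ_alpha (theta := theta) b0)[r h]|[]].
    by exists 1%N, (Frs M r z1); split=> //; apply: E_eq_F_Frs nf _ _ _ h.
  move=> /(in_ZpibetaZ_alpha1 b0)[k1 /sqrt_q_pow[r1 [e1 [eps1 h1]]]].
  move=> /(in_ZpibetaZ_alpha2 b0)[k2 /sqrt_q_pow[r2 [e2 [eps2 h2]]]].
  by eexists 2, _; split; last exact: (E_eq_F_Frs_fee nf h1 h2).
split; last split; last split.
- by split; [|split]; split; auto.
- move=> n F _ EF.
  exact: decoupling_function_of_E_eq_F nf sb0 r11_gt0 r22_gt0 epsilon_def delta_def _ _ EF.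
- by move=> _ r h; apply: E_eq_F_Frs nf _ _ _ h.
- by move=> _ _ r1 r2 e1 e2 eps1 eps2 h1 h2; exact: (E_eq_F_Frs_fee nf h1 h2).
Qed.
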